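(* Let $\alpha>1$. Let $\mathcal{A}$ be an infinite set with a height function, let $\mathcal{A}(N)$ be the finite set of its elements of height at most $N$, and assume $\log|\mathcal{A}(N)|\asymp\log N$. For each prime $p$ let $f_p:\mathcal{A}\to\{-1,0,1\}$. Suppose there exist $\xi>0$ and multiplicative functions $\eta_+,\eta_-$ with values in $[0,1]$ such that for every pair of coprime positive squarefree integers $q_-,q_+$ with $q_-q_+\le N^{\xi/2}$, $$\frac{1}{|\mathcal{A}(N)|}\left|\left\{x\in\mathcal{A}(N): p\mid q_-\Rightarrow f_p(x)=-1,\ p\mid q_+\Rightarrow f_p(x)=1\right\}\right|=\eta_-(q_-)\eta_+(q_+)+O(N^{-\xi}).$$ Assume further there are constants $c_+,c_-,C>0$ and $M_+,M_-$ such that, uniformly for all $N\ge2$: $\eta_\pm(p)\ll 1/p$ for all primes $p$; $\sum_{p\le N}\eta_\pm(p)=c_\pm\log\log N+M_\pm+O(1/\log N)$; and $\max_{x\in\mathcal{A}(N)}\prod_{p:\,f_p(x)\ne0}p\ll N^C$. Then $$|\mathcal{A}(N)|(\log N)^{(\alpha-1)c_+-(1-\alpha^{-1})c_-}\ll\sum_{x\in\mathcal{A}(N)}\prod_p\alpha^{f_p(x)}\ll|\mathcal{A}(N)|(\log N)^{(\alpha-1)c_+},$$ where the implied constants depend only on $\xi,c_\pm,M_\pm,C,\alpha$ and the implied constants in the assumptions. *)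

(* Defs.v *)
From HB Require Import structures.
From mathcomp Require Import all_boot all_order all_algebra.
From mathcomp Require Import all_classical all_reals all_analysis.
Set Implicit Arguments. Unset Strict Implicit. Unset Printing Implicit Defensive.
Import Order.TTheory GRing.Theory Num.Theory.
Import numFieldNormedType.Exports.
Local Open Scope ring_scope.

Definition squarefree (q : nat) : bool :=
  (0 < q)%N && all (fun p => logn p q <= 1)%N (primes q).

Definition mult01 {R : realType} (eta : nat -> R) : Prop :=
  eta 1%N = 1 /\
  (forall m n : nat, (0 < m)%N -> (0 < n)%N -> coprime m n ->
     eta (m * n)%N = eta m * eta n) /\
  (forall n : nat, (0 < n)%N -> 0 <= eta n <= 1).

Definition count_sign {A : eqType} (AN : seq A) (f : nat -> A -> int)
    (qm qp : nat) : nat :=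
  size [seq x <- AN | all (fun p => f p x == -1) (primes qm)
                   && all (fun p => f p x == 1) (primes qp)].

Definition sum_primes_le {R : realType} (N : R) (g : nat -> R) : R :=
  \sum_(p < (Num.truncn N).+1 | prime p) g p.

Definition partial_weight {R : realType} {A : Type} (alpha : R)
    (f : nat -> A -> int) (x : A) (n : nat) : R :=
  \prod_(p < n | prime p) alpha ^ (f p x).

(* the product over all primes  prod_p alpha^{f_p(x)},  defined as the limit
   of the partial products (these are eventually constant when f_.(x) has
   finite support, which the hypotheses guarantee) *)
Definition euler_weight {R : realType} {A : Type} (alpha : R)
    (f : nat -> A -> int) (x : A) : R :=
  limn (partial_weight alpha f x).

Definition partial_supp_prod {R : realType} {A : Type}
    (f : nat -> A -> int) (x : A) (n : nat) : R :=
  \prod_(p < n | prime p && (f p x != 0)) (p%:R : R).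

(* Main.v *)
Require Import Defs.
From HB Require Import structures.
From mathcomp Require Import all_boot all_order all_algebra.
From mathcomp Require Import all_classical all_reals all_analysis.
From mathcomp Require Import ring lra zify.
Import Order.TTheory GRing.Theory Num.Theory.
Import numFieldNormedType.Exports.
Local Open Scope ring_scope.
Local Open Scope classical_set_scope.

(** Write [f_p(x)] through the indicators of [f_p(x) = 1] and [f_p(x) = -1], so that
    [alpha^(f_p)] becomes [(1 + (alpha - 1) ind_1) (1 - (1 - 1/alpha) ind_(-1))].

    Upper bound.  Drop the second factor.  Let [S] be the set of primes with
    [f_p(x) = 1], and [a] the longest initial segment of [S] whose product is at most
    [N^(2d)].  If the next prime exceeds [N^d], only boundedly many primes of [S] lie
    outside [a], and expanding [alpha^|a|] over the subsets of [a] only involves moduli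
    at most [N^(2d)].  Otherwise the next prime lies at a dyadic scale
    [z = N^(d/2^j)]; then [a] is a product of primes up to [z] exceeding [N^d], and
    Rankin's trick with the weight [p^(K/log z)] gains [exp(-K 2^j)], which beats the
    loss [alpha^(O(2^j))] from the primes outside [a], while the weight changes the
    Euler product over [p <= z] by a bounded factor only.

    Lower bound.  Keep the primes up to [N^eps]; the others cost a bounded factor.
    Truncate the expansion of the first factors to divisors at most [N^(xi/8)]; Rankin's
    trick shows that half of the Euler product survives.  For each such divisor, bound
    the product of the second factors from below by the Brun-Hooley sieve: split
    the primes into the layers [(N^(eps/2^(j+1)), N^(eps/2^j)]], truncate each layer at
    an even level growing with [j] by Bonferroni, and telescope the products. *)

(** * Bounds for sums and products over sequences *)

Section SeqBounds.
Context {R : realType} {I : eqType}.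
Implicit Types (s : seq I) (P : pred I) (F G : I -> R).

Lemma ler_sum_seq s P F G :
  (forall i, i \in s -> P i -> F i <= G i) ->
  \sum_(i <- s | P i) F i <= \sum_(i <- s | P i) G i.
Proof.
move=> h; rewrite big_seq_cond [leRHS]big_seq_cond.
by apply: ler_sum => i /andP[]; apply: h.
Qed.

Lemma sumr_ge0_seq s P F :
  (forall i, i \in s -> P i -> 0 <= F i) -> 0 <= \sum_(i <- s | P i) F i.
Proof.
by move=> h; rewrite big_seq_cond; apply: sumr_ge0 => i /andP[]; apply: h.
Qed.

Lemma ler_prod_seq s P F G :
  (forall i, i \in s -> P i -> 0 <= F i <= G i) ->
  \prod_(i <- s | P i) F i <= \prod_(i <- s | P i) G i.
Proof.
move=> h; rewrite big_seq_cond [leRHS]big_seq_cond.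
by apply: ler_prod => i /andP[]; apply: h.
Qed.

Lemma prodr_ge0_seq s P F :
  (forall i, i \in s -> P i -> 0 <= F i) -> 0 <= \prod_(i <- s | P i) F i.
Proof.
by move=> h; rewrite big_seq_cond; apply: prodr_ge0 => i /andP[]; apply: h.
Qed.

Lemma prodr_gt0_seq s P F :
  (forall i, i \in s -> P i -> 0 < F i) -> 0 < \prod_(i <- s | P i) F i.
Proof.
by move=> h; rewrite big_seq_cond; apply: prodr_gt0 => i /andP[]; apply: h.
Qed.

Lemma prodr_le1_seq s P F :
  (forall i, i \in s -> P i -> 0 <= F i <= 1) -> \prod_(i <- s | P i) F i <= 1.
Proof.
move=> h; apply: le_trans (ler_prod_seq s P F (fun=> 1) h) _.
by rewrite big1.
Qed.

Lemma prodr_ge1_seq s P F :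
  (forall i, i \in s -> P i -> 1 <= F i) -> 1 <= \prod_(i <- s | P i) F i.
Proof.
move=> h; rewrite -[leLHS](@big1 R 1 *%R I s P (fun=> 1)) //.
by apply: ler_prod_seq => i si Pi; rewrite ler01 h.
Qed.

Lemma sum_subseq_le s s' P F : subseq s s' ->
  (forall i, i \in s' -> P i -> 0 <= F i) ->
  \sum_(i <- s | P i) F i <= \sum_(i <- s' | P i) F i.
Proof.
elim: s' s => [|y s' IH] s; first by rewrite subseq0 => /eqP ->.
move=> sub h.
have hs' i : i \in s' -> P i -> 0 <= F i.
  by move=> si; apply: h; rewrite inE si orbT.
case: s sub => [_|x s].
  by rewrite big_nil; apply: sumr_ge0_seq.
rewrite /=; case: eqP => [->|_] sub.
  by rewrite !big_cons; case: ifP => _; rewrite ?lerD2l; apply: IH.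
apply: le_trans (IH _ sub hs') _.
rewrite [leRHS]big_cons; case: ifP => // Py.
by rewrite lerDr h // mem_head.
Qed.

Lemma prod1D_le_expR s P F :
  (forall i, i \in s -> P i -> 0 <= 1 + F i) ->
  \prod_(i <- s | P i) (1 + F i) <= expR (\sum_(i <- s | P i) F i).
Proof.
move=> h; rewrite expR_sum; apply: ler_prod_seq => i si Pi.
by rewrite h // expR_ge1Dx.
Qed.

Lemma prod_filterC s P F :
  \prod_(i <- s) F i = (\prod_(i <- s | P i) F i) * \prod_(i <- s | ~~ P i) F i.
Proof. by rewrite (bigID P). Qed.

End SeqBounds.

(** This is [1 - 1/u <= ln u], obtained by inverting [1 + x <= expR x] at [x = 1/u - 1]. The lower
    bounds for single Euler factors go through it. *)
Lemma expR_sub1V_le (R : realType) (u : R) : 0 < u -> expR (1 - u^-1) <= u.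
Proof.
move=> u0; have := expR_ge1Dx (u^-1 - 1); rewrite addrCA subrr addr0 => h.
rewrite -opprB expRN -[leRHS]invrK lef_pV2 // ?posrE ?expR_gt0 //.
by rewrite invr_gt0.
Qed.

(** * Expansions over squarefree divisors and Rankin's trick *)

Section Subseqs.

(** A squarefree integer is represented by the list of its primes, so the members of [subseqs s]
    play the role of the divisors of the product of [s]. *)
Fixpoint subseqs {T : Type} (s : seq T) : seq (seq T) :=
  if s is x :: s' then subseqs s' ++ map (cons x) (subseqs s') else [:: [::]].

Lemma subseq_subseqs {T : eqType} (a s : seq T) :
  subseq a s -> subseq (subseqs a) (subseqs s).
Proof.
elim: s a => [|y s IH] a; first by rewrite subseq0 => /eqP ->.
case: a => [_|x a].
  apply: subseq_trans (IH [::] (sub0seq _)) _; exact: prefix_subseq.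
rewrite /=; case: eqP => [->|_] sub.
  by apply: cat_subseq; [|apply: map_subseq]; apply: IH.
by apply: subseq_trans (IH _ sub) _; apply: prefix_subseq.
Qed.

Lemma mem_subseqs {T : eqType} (D s : seq T) : D \in subseqs s -> subseq D s.
Proof.
elim: s D => [|y s IH] D; first by rewrite inE => /eqP ->.
rewrite mem_cat => /orP[/IH sub|/mapP[D' /IH sub ->]].
  by apply: subseq_trans sub (subseq_cons _ _).
by rewrite /= eqxx.
Qed.

Context {R : realType}.
Implicit Types (s a D : seq nat) (w : nat -> R).

Lemma prod1D_subseqs s w :
  \prod_(p <- s) (1 + w p) = \sum_(D <- subseqs s) \prod_(p <- D) w p.
Proof.
elim: s => [|p s IH]; first by rewrite big_nil big_seq1 big_nil.
rewrite big_cons IH /= big_cat big_map /= mulrDl mul1r; congr (_ + _).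
by rewrite big_distrr /=; apply: eq_bigr => D _; rewrite big_cons.
Qed.

Definition nprod D : R := \prod_(p <- D) p%:R.

Lemma nprod_gt0 D : all prime D -> 0 < nprod D.
Proof.
move=> /allP h; apply: prodr_gt0_seq => p /h pp _.
by rewrite ltr0n prime_gt0.
Qed.

Lemma nprod_ge1 D : all prime D -> 1 <= nprod D.
Proof.
move=> /allP h; apply: prodr_ge1_seq => p /h pp _.
by rewrite ler1n prime_gt0.
Qed.

Lemma nprod_ge0 D : 0 <= nprod D.
Proof. by apply: prodr_ge0. Qed.

Lemma nprod_subseq a s : all prime s -> subseq a s -> nprod a <= nprod s.
Proof.
elim: s a => [|p s IH] a; first by rewrite subseq0 => _ /eqP ->.
case/andP=> pp sp; case: a => [_|x a].
  by rewrite {1}/nprod big_nil; apply: nprod_ge1; rewrite /= pp.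
rewrite /=; case: eqP => [->|_] sub.
  by rewrite /nprod !big_cons ler_wpM2l //; apply: IH.
apply: le_trans (IH _ sp sub) _; rewrite {2}/nprod big_cons ler_peMl ?nprod_ge0 //.
by rewrite ler1n prime_gt0.
Qed.

Lemma nprod_powR D (k : R) : nprod D `^ k = \prod_(p <- D) p%:R `^ k.
Proof.
rewrite /nprod; elim: D => [|p D IH]; first by rewrite !big_nil powR1.
by rewrite !big_cons powRM ?IH //; apply: nprod_ge0.
Qed.

(** The part of the expansion of the product of [1 + w p] over [s] that comes from divisors at most
    [Q], that is, from moduli small enough for the counting hypothesis. *)
Definition subsum s (Q : R) w : R :=
  \sum_(D <- subseqs s | nprod D <= Q) \prod_(p <- D) w p.

Lemma subseqs_prod_ge0 s D w : {in s, forall p, 0 <= w p} ->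
  D \in subseqs s -> 0 <= \prod_(p <- D) w p.
Proof.
move=> w0 /mem_subseqs/mem_subseq sub.
by apply: prodr_ge0_seq => p /sub/w0.
Qed.

Lemma subsum_le_prod s Q w : {in s, forall p, 0 <= w p} ->
  subsum s Q w <= \prod_(p <- s) (1 + w p).
Proof.
move=> w0; rewrite prod1D_subseqs [leRHS](bigID (fun D => nprod D <= Q)) /=.
rewrite lerDl; apply: sumr_ge0_seq => D sD _; exact: subseqs_prod_ge0 sD.
Qed.

(** Every divisor of [nprod a] is at most [Q], so the cut removes nothing from the expansion over
    [a], and the other terms of [subsum] are non-negative. *)
Lemma prod_le_subsum a s Q w : {in s, forall p, 0 <= w p} -> all prime a ->
  subseq a s -> nprod a <= Q -> \prod_(p <- a) (1 + w p) <= subsum s Q w.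
Proof.
move=> w0 ap sub aQ; rewrite prod1D_subseqs.
have -> : \sum_(D <- subseqs a) \prod_(p <- D) w p =
    \sum_(D <- subseqs a | nprod D <= Q) \prod_(p <- D) w p.
  rewrite big_seq [RHS]big_seq_cond; apply: eq_bigl => D.
  case sD: (D \in subseqs a) => //=; apply/esym.
  apply: le_trans aQ; have /mem_subseqs := sD.
  exact: nprod_subseq.
apply: sum_subseq_le; first exact: subseq_subseqs.
by move=> D sD _; apply: subseqs_prod_ge0 sD.
Qed.

(** Rankin's trick: a divisor beyond [Q] satisfies [1 <= (nprod D / Q)^k], and with this factor
    inserted the sum over all divisors is an Euler product again. *)
Lemma subsum_tail s Q w (k : R) : {in s, forall p, 0 <= w p} ->
  0 <= k -> 0 < Q ->
  \prod_(p <- s) (1 + w p) - subsum s Q w <=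
  Q `^ (- k) * \prod_(p <- s) (1 + w p * p%:R `^ k).
Proof.
move=> w0 k0 Q0; rewrite !prod1D_subseqs (bigID (fun D => nprod D <= Q)) /=.
rewrite addrAC subrr add0r big_distrr /=.
rewrite [leRHS](bigID (fun D => nprod D <= Q)) /=.
rewrite -[leLHS]add0r; apply: lerD.
  apply: sumr_ge0_seq => D sD _; rewrite mulr_ge0 ?powR_ge0 //.
  by apply: subseqs_prod_ge0 sD => p /w0 wp; rewrite mulr_ge0 ?powR_ge0.
apply: ler_sum_seq => D sD; rewrite -ltNge => QD.
rewrite big_split /= -nprod_powR mulrCA ler_peMr ?(subseqs_prod_ge0 _ _ _ w0 sD) //.
rewrite powRN mulrC ler_pdivlMr ?powR_gt0 // mul1r.
by rewrite ge0_ler_powR ?nnegrE ?nprod_ge0 // ltW.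
Qed.

(** Rankin's trick for divisors up to [Q]: here [1 <= (Q / nprod D)^2], and the exponent 2 keeps the
    resulting Euler product bounded when [w] is bounded. Error terms are summed over divisors in
    this way. *)
Lemma subsum_le_sqr s Q w : {in s, forall p, 0 <= w p} -> all prime s ->
  subsum s Q w <= Q ^+ 2 * \prod_(p <- s) (1 + w p / p%:R ^+ 2).
Proof.
move=> w0 /allP sp; rewrite prod1D_subseqs big_distrr /=.
rewrite [leRHS](bigID (fun D => nprod D <= Q)) /=.
rewrite -[leLHS]addr0; apply: lerD; last first.
  apply: sumr_ge0_seq => D sD _; rewrite mulr_ge0 ?sqr_ge0 //.
  by apply: subseqs_prod_ge0 sD => p /w0 wp; rewrite divr_ge0 ?sqr_ge0.
apply: ler_sum_seq => D sD DQ.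
have D0 : 0 < nprod D.
  apply: nprod_gt0; apply/allP => p pD; apply: sp.
  by move: p pD; apply: mem_subseq; apply: mem_subseqs.
rewrite big_split /= mulrCA ler_peMr ?(subseqs_prod_ge0 _ _ _ w0 sD) //.
rewrite prodfV prodrXl -/(nprod D).
rewrite ler_pdivlMr ?exprn_gt0 // mul1r ler_pXn2r ?nnegrE ?nprod_ge0 //.
exact: le_trans (ltW D0) DQ.
Qed.

End Subseqs.

(** * Primes up to a real bound *)

Section PrimesUpto.
Context {R : realType}.
Implicit Types (z l : R).

Definition primes_upto z : seq nat :=
  [seq p <- iota 0 (Num.truncn z).+1 | prime p].

Lemma mem_primes_upto z p : (p \in primes_upto z) = prime p && (p%:R <= z).
Proof.
rewrite mem_filter mem_iota add0n ltnS /=; case: (boolP (prime p)) => //= pp.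
have [z0|z0] := leP 0 z; first by rewrite truncn_ge_nat.
rewrite [RHS]leNgt (lt_le_trans z0) //=.
have /truncn0Pn -> : ~~ (1 <= z) by rewrite -ltNge (lt_trans z0).
by rewrite leqNgt prime_gt0.
Qed.

Lemma all_prime_upto z : all prime (primes_upto z).
Proof. exact: filter_all. Qed.

Lemma primes_upto_uniq z : uniq (primes_upto z).
Proof. by rewrite filter_uniq // iota_uniq. Qed.

Lemma primes_upto_sorted z : sorted ltn (primes_upto z).
Proof. by rewrite sorted_filter ?iota_ltn_sorted //; apply: ltn_trans. Qed.

Lemma sum_primes_leE z (g : nat -> R) :
  sum_primes_le z g = \sum_(p <- primes_upto z) g p.
Proof. by rewrite big_filter /sum_primes_le -(big_mkord prime) /index_iota subn0. Qed.

Lemma primes_upto_lt2 z : z < 2 -> primes_upto z = [::].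
Proof.
move=> z2; apply/eqP; rewrite -size_eq0 -leqn0 leqNgt -has_predT; apply/hasPn => p.
rewrite mem_primes_upto => /andP[/prime_gt1 p1 pz].
by move: (le_lt_trans pz z2); rewrite ltr_nat ltnNge p1.
Qed.

Lemma primes_upto_filter z z' : z' <= z ->
  perm_eq [seq p <- primes_upto z | p%:R <= z'] (primes_upto z').
Proof.
move=> zz; apply: uniq_perm; [exact: filter_uniq (primes_upto_uniq _)|
  exact: primes_upto_uniq|move=> p].
rewrite mem_filter !mem_primes_upto; case: (prime p) => //=; rewrite ?andbF //.
by case: (leP p%:R z') => //= h; rewrite (le_trans h zz).
Qed.

(** Induction on the sharper bound [2 - 1/(m+1)] for the primes up to [m + 1], with the telescoping
    estimate [1/(n+1)^2 <= 1/n - 1/(n+1)]. *)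
Lemma sum_inv_sqr_le2 z : \sum_(p <- primes_upto z) (p%:R ^+ 2)^-1 <= 2 :> R.
Proof.
rewrite big_filter.
have h m : \sum_(p <- iota 0 m.+2 | prime p) (p%:R ^+ 2)^-1 <= 2 - (m.+1%:R)^-1 :> R.
  elim: m => [|m IH]; first by rewrite /= !big_cons big_nil /= invr1; lra.
  have step : (m.+2%:R ^+ 2)^-1 <= m.+1%:R^-1 - m.+2%:R^-1 :> R.
    have x0 : 0 < m.+1%:R :> R by rewrite ltr0n.
    rewrite -[m.+2%:R]natr1; set x := m.+1%:R in x0 *.
    have -> : x^-1 - (x + 1)^-1 = (x * (x + 1))^-1 by field; apply/andP; split; lra.
    by rewrite lef_pV2 ?posrE; nra.
  have -> : iota 0 m.+3 = iota 0 m.+2 ++ [:: m.+2] by rewrite -[m.+3]addn1 iotaD.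
  move: (iota 0 m.+2) IH => s IH; rewrite big_cat /= big_cons big_nil.
  have d0 : 0 <= (m.+2%:R ^+ 2)^-1 :> R by rewrite invr_ge0 sqr_ge0.
  move: (m.+2%:R ^+ 2)^-1 (m.+1%:R^-1) (m.+2%:R^-1) step IH d0 => d a b step IH d0.
  case: ifP => _; lra.
case: (Num.truncn z) => [|m]; first by rewrite big_cons big_nil /=.
by apply: le_trans (h m) _; rewrite gerBl invr_ge0.
Qed.

Lemma prod1D_inv_sqr_le z (A : R) : 0 <= A ->
  \prod_(p <- primes_upto z) (1 + A / p%:R ^+ 2) <= expR (2 * A).
Proof.
move=> A0; apply: (le_trans (prod1D_le_expR _ _ _ _)).
  by move=> p _ _; rewrite addr_ge0 // divr_ge0 // sqr_ge0.
rewrite ler_expR -big_distrr /= mulrC ler_wpM2r //; exact: sum_inv_sqr_le2.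
Qed.

End PrimesUpto.

(** * Sums over primes of Mertens type *)

Definition mertens {R : realType} (c M E : R) (eta : nat -> R) : Prop :=
  forall N, 2 <= N ->
    `| \sum_(p <- primes_upto N) eta p - (c * ln (ln N) + M) | <= E / ln N.

(** [c * ln 2] is the growth of [c * ln ln] between [expR (l / 2)] and [expR l]; [3 * |E| / ln 2]
    covers the error terms at both ends; 4 covers the scales with [expR (l / 2) < 2], where at most
    four integers are counted with weight at most 1. *)
Definition dyadic_bound {R : realType} (c E : R) : R :=
  c * ln 2 + 3 * `|E| / ln 2 + 4.

Section Mertens.
Context {R : realType}.
Implicit Types (c M E l k K : R) (eta : nat -> R).

Lemma ln2_gt0 : 0 < ln 2 :> R.
Proof. by apply: ln_gt0; lra. Qed.

Lemma dyadic_bound_ge0 c E : 0 <= c -> 0 <= dyadic_bound c E.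
Proof.
move=> c0; rewrite /dyadic_bound !addr_ge0 ?mulr_ge0 ?invr_ge0 //.
all: exact: ltW ln2_gt0.
Qed.

(** Passing from [expR (l / 2)] to [expR l] raises [ln ln] by just [ln 2], so such a block of primes
    carries a mass bounded independently of [l]. *)
Lemma sum_dyadic_le c M E eta l : 0 <= c -> mertens c M E eta ->
  (forall p, prime p -> 0 <= eta p <= 1) -> 0 <= l ->
  \sum_(p <- primes_upto (expR l) | expR (l / 2) < p%:R) eta p
    <= dyadic_bound c E.
Proof.
move=> c0 H eta01 l0; rewrite /dyadic_bound.
have ln20 := ln2_gt0.
have cl : 0 <= c * ln 2 by rewrite mulr_ge0 // ltW.
have El : 0 <= 3 * `|E| / ln 2 by rewrite divr_ge0 ?mulr_ge0 // ltW.
have [h2|h2] := leP 2 (expR (l / 2)); last first.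
  have l4 : expR l < 4.
    have -> : l = l / 2 + l / 2 by lra.
    rewrite expRD; have := expR_gt0 (l / 2); nra.
  apply: (@le_trans _ _ (\sum_(p <- primes_upto (expR l)) 1)).
    rewrite [leRHS](bigID (fun p => expR (l / 2) < p%:R)) /= -[leLHS]addr0.
    apply: lerD; last by apply: sumr_ge0.
    apply: ler_sum_seq => p; rewrite mem_primes_upto => /andP[pp _] _.
    by have /andP[] := eta01 _ pp.
  rewrite big_const_seq iter_addr_0 count_predT.
  apply: (@le_trans _ _ 4); last lra.
  rewrite ler_nat; apply: leq_trans (_ : size (iota 0 (Num.truncn (expR l)).+1) <= _)%N.
    by rewrite size_filter count_size.
  rewrite size_iota truncn_lt_nat //; exact: expR_ge0.
have lln : ln 2 <= l / 2.
  by rewrite -[leRHS]expRK ler_ln ?posrE ?expR_gt0 //; lra.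
have l1 : 0 < l by lra.
have hl : 2 <= expR l by apply: le_trans h2 _; rewrite ler_expR; lra.
have ehalf : expR (l / 2) <= expR l by rewrite ler_expR; lra.
have := H _ h2; have := H _ hl; rewrite !expRK.
have -> : \sum_(p <- primes_upto (expR l)) eta p =
    \sum_(p <- primes_upto (expR (l / 2))) eta p +
    \sum_(p <- primes_upto (expR l) | expR (l / 2) < p%:R) eta p.
  rewrite (bigID (fun p => p%:R <= expR (l / 2))) /=; congr (_ + _).
    by rewrite -big_filter; apply: perm_big; apply: primes_upto_filter.
  by apply: eq_bigl => p; rewrite ltNge.
set S1 := \sum_(p <- primes_upto (expR (l / 2))) _.
set S2 := \sum_(p <- _ | _) _.
rewrite ln_div ?posrE //.
rewrite !ler_norml => /andP[_ h3] /andP[h4 _].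
have e1 : E / l <= `|E| / ln 2.
  apply: (@le_trans _ _ (`|E| / l)); first by rewrite ler_wpM2r ?invr_ge0 ?ler_norm // ltW.
  by rewrite ler_wpM2l // lef_pV2 ?posrE //; lra.
have e2 : E / (l / 2) <= 2 * (`|E| / ln 2).
  have -> : E / (l / 2) = 2 * (E / l) by field; lra.
  lra.
have -> : 3 * `|E| / ln 2 = 3 * (`|E| / ln 2) by rewrite mulrA.
lra.
Qed.

(** Halve [l] repeatedly. With [L] the dyadic bound, the top block contributes at most [L * l] and
    the rest at most [2 * L * (l / 2)], which add up to [2 * L * l]. *)
Lemma sum_eta_ln_le c M E eta l : 0 <= c -> mertens c M E eta ->
  (forall p, prime p -> 0 <= eta p <= 1) -> 0 <= l ->
  \sum_(p <- primes_upto (expR l)) eta p * ln p%:R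
    <= 2 * dyadic_bound c E * l.
Proof.
move=> c0 H eta01.
have L0 := dyadic_bound_ge0 c E c0.
have ln20 := ln2_gt0.
have base m : 0 <= m -> m < ln 2 ->
    \sum_(p <- primes_upto (expR m)) eta p * ln p%:R <= 2 * dyadic_bound c E * m.
  move=> m0 m2; rewrite primes_upto_lt2 ?big_nil ?mulr_ge0 //.
  by rewrite -[ltRHS]lnK ?posrE ?ltr_expR //; lra.
(* Here [n] counts the halvings that bring [m] below [ln 2], where no prime is left. *)
suff h n m : 0 <= m -> m < ln 2 * 2 ^+ n ->
    \sum_(p <- primes_upto (expR m)) eta p * ln p%:R <= 2 * dyadic_bound c E * m.
  move=> l0; apply: (h (Num.truncn (l / ln 2)).+1) => //.
  rewrite mulrC -ltr_pdivrMr //; apply: lt_le_trans (truncnS_gt _) _.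
  by rewrite -natrX ler_nat ltnW // ltn_expl.
elim: n m => [|n IH] m m0 mn; first by apply: base => //; rewrite mulr1 in mn.
have {IH} := IH (m / 2); rewrite exprS in mn.
move=> /(_ ltac:(lra) ltac:(lra)) IH.
have ehalf : expR (m / 2) <= expR m by rewrite ler_expR; lra.
rewrite (bigID (fun p => p%:R <= expR (m / 2))) /=.
rewrite -big_filter (perm_big _ (primes_upto_filter _ _ ehalf)) /=.
have : \sum_(p <- primes_upto (expR m) | ~~ (p%:R <= expR (m / 2))) eta p * ln p%:R
    <= (\sum_(p <- primes_upto (expR m) | expR (m / 2) < p%:R) eta p) * m.
  rewrite big_distrl /=; under eq_bigl do rewrite -ltNge.
  apply: ler_sum_seq => p; rewrite mem_primes_upto => /andP[pp pm] _.
  have /andP[e0 _] := eta01 _ pp; rewrite ler_wpM2l //.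
  by rewrite -[leRHS]expRK ler_ln ?posrE ?expR_gt0 // ltr0n prime_gt0.
have := sum_dyadic_le _ _ _ _ _ c0 H eta01 m0.
nra.
Qed.

(* Rankin's trick costs only a constant factor as long as [p^k] stays bounded. *)
Lemma sum_eta_powR_sub1_le c M E eta l k K : 0 <= c -> mertens c M E eta ->
  (forall p, prime p -> 0 <= eta p <= 1) -> 0 <= l -> 0 <= k -> k * l <= K ->
  \sum_(p <- primes_upto (expR l)) eta p * (p%:R `^ k - 1)
    <= 2 * dyadic_bound c E * K * expR K.
Proof.
move=> c0 H eta01 l0 k0 klK.
have L0 := dyadic_bound_ge0 c E c0.
apply: (@le_trans _ _ (k * expR K *
    \sum_(p <- primes_upto (expR l)) eta p * ln p%:R)).
  rewrite big_distrr /=; apply: ler_sum_seq => p.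
  rewrite mem_primes_upto => /andP[pp pl] _.
  have p0 : 0 < p%:R :> R by rewrite ltr0n prime_gt0.
  have /andP[e0 _] := eta01 _ pp; rewrite mulrCA ler_wpM2l //.
  have lp0 : 0 <= ln p%:R :> R by rewrite ln_ge0 // ler1n prime_gt0.
  have lpl : ln p%:R <= l by rewrite -[leRHS]expRK ler_ln ?posrE ?expR_gt0.
  rewrite /powR gt_eqF //; set y := k * ln p%:R.
  have y0 : 0 <= y by rewrite mulr_ge0.
  have yK : y <= K by apply: le_trans klK; rewrite ler_wpM2l.
  have -> : k * expR K * ln p%:R = y * expR K by rewrite /y; ring.
  have : expR y <= expR K by rewrite ler_expR.
  have ey := expR_gt0 y.
  (* Equivalently [expR y - 1 <= y * expR y], which bounds [p^k - 1] linearly in [ln p]. *)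
  have : (1 - y) * expR y <= 1.
    by rewrite -ler_pdivlMr // div1r -expRN; apply: expR_ge1Dx.
  nra.
apply: (le_trans (ler_wpM2l _ (sum_eta_ln_le _ _ _ _ _ c0 H eta01 l0))).
  by rewrite mulr_ge0 // expR_ge0.
have -> : k * expR K * (2 * dyadic_bound c E * l) =
  2 * dyadic_bound c E * (k * l) * expR K by ring.
by rewrite ler_wpM2r ?expR_ge0 // ler_wpM2l // mulr_ge0.
Qed.

Lemma sum_eta_le c M E eta N z : mertens c M E eta ->
  (forall p, prime p -> 0 <= eta p <= 1) -> 2 <= N -> z <= N ->
  \sum_(p <- primes_upto z) eta p <= c * ln (ln N) + (M + `|E| / ln 2).
Proof.
move=> H eta01 N2 zN; have ln20 := ln2_gt0.
have : \sum_(p <- primes_upto z) eta p <= \sum_(p <- primes_upto N) eta p.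
  rewrite [leRHS](bigID (fun p => p%:R <= z)) /=.
  rewrite -[X in _ <= X + _]big_filter (perm_big _ (primes_upto_filter _ _ zN)) /= lerDl.
  apply: sumr_ge0_seq => p; rewrite mem_primes_upto => /andP[pp _] _.
  by have /andP[] := eta01 _ pp.
have lN : ln 2 <= ln N by rewrite ler_ln ?posrE //; lra.
have e1 : E / ln N <= `|E| / ln 2.
  apply: (@le_trans _ _ (`|E| / ln N)).
    by rewrite ler_wpM2r ?invr_ge0 ?ler_norm //; lra.
  by rewrite ler_wpM2l // lef_pV2 ?posrE //; lra.
have := H _ N2; rewrite ler_norml => /andP[_]; lra.
Qed.

Lemma sum_eta_ge c M E eta N : mertens c M E eta -> 2 <= N ->
  c * ln (ln N) + (M - `|E| / ln 2) <= \sum_(p <- primes_upto N) eta p.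
Proof.
move=> H N2; have ln20 := ln2_gt0.
have lN : ln 2 <= ln N by rewrite ler_ln ?posrE //; lra.
have e1 : E / ln N <= `|E| / ln 2.
  apply: (@le_trans _ _ (`|E| / ln N)).
    by rewrite ler_wpM2r ?invr_ge0 ?ler_norm //; lra.
  by rewrite ler_wpM2l // lef_pV2 ?posrE //; lra.
have := H _ N2; rewrite ler_norml => /andP[]; lra.
Qed.

End Mertens.

(** * Elementary symmetric functions and Bonferroni's inequalities *)

Section ElementarySymmetric.
Context {R : realType}.
Implicit Types (s : seq nat) (y : nat -> R) (k : nat).

Fixpoint elem_sym y k s : R :=
  match s, k with
  | _, 0 => 1
  | [::], _.+1 => 0
  | p :: s', k'.+1 => elem_sym y k s' + y p * elem_sym y k' s'
  end.

Lemma elem_sym0 y s : elem_sym y 0 s = 1.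
Proof. by case: s. Qed.

Lemma elem_sym_ge0 y k s : {in s, forall p, 0 <= y p} -> 0 <= elem_sym y k s.
Proof.
elim: s k => [|p s IH] [|k] //= y0; have y0s : {in s, forall q, 0 <= y q}.
  by move=> q qs; apply: y0; rewrite inE qs orbT.
by rewrite addr_ge0 ?mulr_ge0 ?IH // y0 ?mem_head.
Qed.

(** Each product of [k] terms at distinct positions occurs [k!] times in the expansion of the power.
    The induction keeps two terms of the binomial expansion:
    [S^(k+1) + (k+1) y S^k <= (y + S)^(k+1)]. *)
Lemma elem_sym_le_expn y k s : {in s, forall p, 0 <= y p} ->
  elem_sym y k s <= (\sum_(p <- s) y p) ^+ k / k`!%:R.
Proof.
elim: s k => [|p s IH] [|k] y0; rewrite ?elem_sym0 ?fact0 ?expr0 ?divr1 //=.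
  by rewrite big_nil expr0n mul0r.
have y0s : {in s, forall q, 0 <= y q}.
  by move=> q qs; apply: y0; rewrite inE qs orbT.
have p0 : 0 <= y p by rewrite y0 ?mem_head.
have S0 : 0 <= \sum_(q <- s) y q by apply: sumr_ge0_seq => q /y0s.
have := IH k.+1 y0s; have := IH k y0s; rewrite big_cons.
move: (\sum_(q <- s) y q) S0 => S S0 h1 h2.
apply: (le_trans (lerD h2 (ler_wpM2l p0 h1))).
have kf : 0 < k`!%:R :> R by rewrite ltr0n fact_gt0.
have k1 : 0 < k.+1%:R :> R by rewrite ltr0n.
rewrite factS natrM ler_pdivlMr ?mulr_gt0 // mulrDl divfK ?mulf_neq0 ?gt_eqF //.
have -> : y p * (S ^+ k / k`!%:R) * (k.+1%:R * k`!%:R) = k.+1%:R * y p * S ^+ k.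
  by field; rewrite gt_eqF.
clear -S0 p0; elim: k => [|k IH]; first by rewrite !expr1 expr0; lra.
rewrite exprS [(y p + S) ^+ _]exprS -[k.+2%:R]natr1.
have : (y p + S) * (S ^+ k.+1 + k.+1%:R * y p * S ^+ k) <= (y p + S) * (y p + S) ^+ k.+1.
  by rewrite ler_wpM2l // addr_ge0.
apply: le_trans; rewrite exprS.
have : 0 <= S ^+ k by rewrite exprn_ge0.
have : 0 <= k.+1%:R :> R by [].
move: (S ^+ k) k.+1%:R => T n n0 T0.
have : 0 <= y p * (n * y p * T) by rewrite !mulr_ge0.
nra.
Qed.

(** Inclusion-exclusion for the product of [1 - y p] over [s], cut after degree [k]. *)
Definition bonf y k s : R := \sum_(i < k.+1) (-1) ^+ i * elem_sym y i s.

Lemma bonf_cons y k p s :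
  bonf y k.+1 (p :: s) = bonf y k.+1 s - y p * bonf y k s.
Proof.
rewrite /bonf big_ord_recl [X in _ = X - _]big_ord_recl !elem_sym0 -addrA.
congr (_ + _); rewrite big_distrr /= -sumrB; apply: eq_bigr => i _ /=.
by rewrite /bump /= add1n exprS; ring.
Qed.

(** By [bonf_cons], the truncation error at level [k + 1] for [p :: s] is [1] times the error at
    level [k + 1] for [s] minus [y p] times the error at level [k]. These two errors have opposite
    signs, so the contributions agree in sign. *)
Lemma bonf_sign y k s : {in s, forall p, 0 <= y p <= 1} ->
  0 <= (-1) ^+ k * (bonf y k s - \prod_(p <- s) (1 - y p)).
Proof.
elim: s k => [|p s IH] k y01.
  rewrite /bonf big_nil big_ord_recl big1 /=.
    by rewrite expr0 mul1r addr0 subrr mulr0.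
  by move=> i _; rewrite mulr0.
have y0s : {in s, forall q, 0 <= y q <= 1}.
  by move=> q qs; apply: y01; rewrite inE qs orbT.
have /andP[p0 p1] : 0 <= y p <= 1 by rewrite y01 ?mem_head.
rewrite big_cons; case: k => [|k].
  rewrite /bonf big_ord_recl big_ord0 elem_sym0 !expr0 !mul1r addr0 subr_ge0.
  have : \prod_(j <- s) (1 - y j) <= 1.
    by apply: prodr_le1_seq => q /y0s; lra.
  have : 0 <= \prod_(j <- s) (1 - y j).
    by apply: prodr_ge0_seq => q /y0s; lra.
  nra.
have := IH k y0s; have := IH k.+1 y0s; rewrite bonf_cons !exprS.
move: (bonf y k s) (bonf y k.+1 s) (\prod_(j <- s) _) ((-1) ^+ k) => b b' P e.
nra.
Qed.

Lemma bonf_even_ge y k s : ~~ odd k -> {in s, forall p, 0 <= y p <= 1} ->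
  \prod_(p <- s) (1 - y p) <= bonf y k s.
Proof.
move=> ek y01; have := bonf_sign y k s y01.
by rewrite -signr_odd (negbTE ek) expr0 mul1r subr_ge0.
Qed.

Lemma bonf_even_le y k s : ~~ odd k -> {in s, forall p, 0 <= y p <= 1} ->
  bonf y k s - elem_sym y k.+1 s <= \prod_(p <- s) (1 - y p).
Proof.
move=> ek y01; have := bonf_sign y k.+1 s y01.
rewrite /bonf big_ord_recr /= -signr_odd /= (negbTE ek) expr1.
by rewrite -/(bonf y k s); lra.
Qed.

(** With all signs positive the truncated expansion is a part of the full product. This bounds the
    error weight of a Bonferroni sum by an Euler product, whatever the level. *)
Lemma sum_elem_sym_le y k s : {in s, forall p, 0 <= y p} ->
  \sum_(i < k.+1) elem_sym y i s <= \prod_(p <- s) (1 + y p).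
Proof.
elim: s k => [|p s IH] k y0.
  by rewrite big_nil big_ord_recl big1 /= ?addr0.
have y0s : {in s, forall q, 0 <= y q}.
  by move=> q qs; apply: y0; rewrite inE qs orbT.
have p0 : 0 <= y p by rewrite y0 ?mem_head.
have P1 : 1 <= \prod_(q <- s) (1 + y q).
  by apply: prodr_ge1_seq => q /y0s; lra.
rewrite big_cons; case: k => [|k].
  by rewrite big_ord_recl big_ord0 elem_sym0 addr0; nra.
have := IH k.+1 y0s; have := IH k y0s.
have -> : \sum_(i < k.+2) elem_sym y i (p :: s) =
    \sum_(i < k.+2) elem_sym y i s + y p * \sum_(i < k.+1) elem_sym y i s.
  rewrite big_ord_recl [X in _ = X + _]big_ord_recl !elem_sym0 -addrA.
  by congr (_ + _); rewrite big_distrr -big_split.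
nra.
Qed.

End ElementarySymmetric.

(** * Polynomials in the indicators, evaluated with error terms *)

Section SievePolynomials.
Context {R : realType} {A : Type}.
Context (X : seq A) (g : A -> R) (ind : nat -> A -> R) (eta : nat -> R).
Context (M E Y theta : R) (E0 : 0 <= E) (theta01 : 0 <= theta <= 1).
Implicit Types (B D s : seq nat) (F : A -> R) (v w Q z l : R).

(* [F] is a polynomial in the indicators [ind p], [p \in B], of "degree" at most
   [Q]; [v] is its value at [eta], and [w] that of its absolute value at [1/p^2].
   Scaling the error by [(Y / nprod D)^2] makes [w] multiplicative. *)
Definition sifted B F v w Q : Prop := forall D,
  uniq D -> all prime D -> all (fun p => p \notin B) D -> nprod D * Q <= Y ->
  `| \sum_(x <- X) g x * F x * \prod_(p <- D) ind p x
     - M * (v * \prod_(p <- D) eta p) | <= E * w * (Y / nprod D) ^+ 2.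

Lemma eq_sifted B F F' v v' w w' Q : F =1 F' -> v = v' -> w = w' ->
  sifted B F v w Q -> sifted B F' v' w' Q.
Proof.
move=> eF <- <- h D uD pD BD DQ.
rewrite [X in `|X - _|](eq_bigr (fun x => g x * F x * \prod_(p <- D) ind p x)).
  exact: h.
by move=> x _; rewrite eF.
Qed.

Lemma sifted_mono B B' F v w w' Q Q' : {subset B <= B'} -> w <= w' -> Q <= Q' ->
  sifted B F v w Q -> sifted B' F v w' Q'.
Proof.
move=> BB ww QQ h D uD pD BD DQ; apply: (le_trans (h D uD pD _ _)).
- apply/allP => p pD'; have := allP BD _ pD'; apply: contra; exact: BB.
- by apply: le_trans DQ; rewrite ler_wpM2l ?nprod_ge0.
- by rewrite ler_wpM2r ?sqr_ge0 // ler_wpM2l.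
Qed.

Lemma siftedD B F1 F2 v1 v2 w1 w2 Q : sifted B F1 v1 w1 Q ->
  sifted B F2 v2 w2 Q -> sifted B (fun x => F1 x + F2 x) (v1 + v2) (w1 + w2) Q.
Proof.
move=> h1 h2 D uD pD BD DQ; rewrite mulrDr mulrDl.
apply: le_trans (lerD (h1 D uD pD BD DQ) (h2 D uD pD BD DQ)).
apply: le_trans (ler_normD _ _); rewrite le_eqVlt; apply/orP; left; apply/eqP.
congr (`| _ |); rewrite addrACA -big_split /= mulrDl mulrDr opprD; congr (_ + _).
by apply: eq_bigr => x _; rewrite mulrDr mulrDl.
Qed.

Lemma siftedZ (c : R) B F v w Q : sifted B F v w Q ->
  sifted B (fun x => c * F x) (c * v) (`|c| * w) Q.
Proof.
move=> h D uD pD BD DQ; have {}h := h D uD pD BD DQ.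
rewrite [X in `|X - _|](_ : _ =
    c * \sum_(x <- X) g x * F x * \prod_(p <- D) ind p x); last first.
  by rewrite big_distrr; apply: eq_bigr => x _ /=; ring.
rewrite -mulrA [M * _]mulrCA -mulrBr normrM [E * _]mulrCA -[leRHS]mulrA.
by rewrite ler_wpM2l.
Qed.

(** The estimate for [F] is applied with [p :: D] in place of [D]. The scale [(Y / nprod D)^2] then
    yields the factor [1 / p^2] of the weight, and the degree grows by the factor [p]. *)
Lemma siftedM_ind p B F v w Q : prime p -> p \notin B -> sifted B F v w Q ->
  sifted (p :: B) (fun x => F x * ind p x) (v * eta p) (w / p%:R ^+ 2) (Q * p%:R).
Proof.
move=> pp pB h D uD pD BD DQ.
have p0 : 0 < p%:R :> R by rewrite ltr0n prime_gt0.
have D0 : 0 < nprod D :> R by apply: nprod_gt0.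
have npD : nprod (p :: D) = p%:R * nprod D :> R by rewrite /nprod big_cons.
have pD' : p \notin D.
  by apply/negP => /(allP BD); rewrite mem_head.
have {}h : `| \sum_(x <- X) g x * F x * \prod_(q <- p :: D) ind q x
     - M * (v * \prod_(q <- p :: D) eta q) | <= E * w * (Y / nprod (p :: D)) ^+ 2.
  apply: h => /=; rewrite ?pD' ?pp ?pB //=.
    by apply: sub_all BD => q; rewrite inE negb_or => /andP[].
  by have -> : nprod (p :: D) * Q = nprod D * (Q * p%:R) by rewrite npD; ring.
rewrite [X in `|X - _|](eq_bigr (fun x => g x * F x * \prod_(q <- p :: D) ind q x)).
  rewrite -[v * eta p * _]mulrA -(big_cons _ _ p D xpredT eta).
  apply: (le_trans h); rewrite npD le_eqVlt; apply/orP; left; apply/eqP.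
  by field; rewrite !gt_eqF.
by move=> x _; rewrite big_cons; ring.
Qed.

Lemma sifted0 B Q : sifted B (fun=> 0) 0 0 Q.
Proof.
move=> D uD pD BD DQ; rewrite big1 => [|x _]; last by rewrite mulr0 mul0r.
by rewrite mul0r !mulr0 mul0r subrr normr0.
Qed.

Let th0 : 0 <= theta. Proof. by case/andP: theta01. Qed.

(** Induction along the recursion of [elem_sym]: taking the head [p] multiplies by [theta * ind p]
    and costs a factor [p <= z] in the degree. Since [theta] is non-negative, the weight follows the
    same recursion. *)
Lemma sifted_elem_sym B F v w Q z s k : 0 <= Q -> 1 <= z -> uniq s -> all prime s ->
  all (fun p => p \notin B) s -> all (fun p => p%:R <= z) s ->
  sifted B F v w Q ->
  sifted (s ++ B) (fun x => F x * elem_sym (fun p => theta * ind p x) k s)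
    (v * elem_sym (fun p => theta * eta p) k s)
    (w * elem_sym (fun p => theta / p%:R ^+ 2) k s) (Q * z ^+ k).
Proof.
move=> Q0 z1; elim: s k => [|p s IH] k us ps sB sz h.
  case: k => [|k] /=.
    by rewrite expr0 [Q * 1]mulr1; apply: eq_sifted h => [x||]; rewrite ?mulr1.
  by apply: eq_sifted (sifted0 B _) => [x||]; rewrite ?mulr0.
case/andP: us => us1 us2; case/andP: ps => pp ps.
case/andP: sB => pB sB; case/andP: sz => pz sz.
case: k => [|k].
  rewrite expr0 [Q * 1]mulr1.
  apply: (@eq_sifted _ F _ v _ w) => [x|||]; rewrite ?elem_sym0 ?mulr1 //.
  by apply: sifted_mono h => // q qB; rewrite mem_cat qB orbT.
have zk0 : 0 <= z ^+ k by rewrite exprn_ge0 //; lra.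
have h1 := IH k.+1 us2 ps sB sz h.
have h2 := IH k us2 ps sB sz h.
have psB : p \notin s ++ B by rewrite mem_cat negb_or us1.
have {}h2 := siftedZ theta _ _ _ _ _ (siftedM_ind _ _ _ _ _ _ pp psB h2).
have sub : {subset s ++ B <= p :: s ++ B} by move=> q qB; rewrite inE qB orbT.
have {}h1 := sifted_mono _ _ _ _ _ _ _ _ sub (lexx _) (lexx _) h1.
have leQ : Q * z ^+ k * p%:R <= Q * z ^+ k.+1.
  by rewrite exprSr -!mulrA ler_wpM2l // ler_wpM2l.
have {}h2 := sifted_mono _ _ _ _ _ _ _ _ (fun q => id) (lexx _) leQ h2.
apply: eq_sifted (siftedD _ _ _ _ _ _ _ _ h1 h2) => [x||] /=; rewrite ?ger0_norm //; ring.
Qed.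

(** Weights measure absolute values, so the alternating signs disappear from them and the weights of
    the degrees up to [k] add up. *)
Lemma sifted_bonf B F v w Q z s k : 0 <= Q -> 1 <= z -> uniq s -> all prime s ->
  all (fun p => p \notin B) s -> all (fun p => p%:R <= z) s ->
  sifted B F v w Q ->
  sifted (s ++ B) (fun x => F x * bonf (fun p => theta * ind p x) k s)
    (v * bonf (fun p => theta * eta p) k s)
    (w * \sum_(i < k.+1) elem_sym (fun p => theta / p%:R ^+ 2) i s) (Q * z ^+ k).
Proof.
move=> Q0 z1 us ps sB sz h.
have he i := sifted_elem_sym _ _ _ _ _ _ _ i Q0 z1 us ps sB sz h.
elim: k => [|k IH].
  apply: eq_sifted (he 0%N) => [x||]; rewrite /bonf !big_ord_recl !big_ord0 !elem_sym0;
    by rewrite ?expr0 ?mul1r ?addr0.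
have leQ : Q * z ^+ k <= Q * z ^+ k.+1 by rewrite ler_wpM2l // ler_weXn2l.
have {}IH := sifted_mono _ _ _ _ _ _ _ _ (fun q => id) (lexx _) leQ IH.
have h2 := siftedZ ((-1) ^+ k.+1) _ _ _ _ _ (he k.+1).
apply: eq_sifted (siftedD _ _ _ _ _ _ _ _ IH h2) => [x||] /=.
- by rewrite /bonf [in RHS]big_ord_recr /=; ring.
- by rewrite /bonf [in RHS]big_ord_recr /=; ring.
- by rewrite [in RHS]big_ord_recr /= normrX normrN1 expr1n; ring.
Qed.

End SievePolynomials.

(** * The Brun-Hooley sieve over dyadic layers *)

Section BrunHooley.
Context {R : realType}.
Implicit Types (D s : seq nat) (y : nat -> R) (l : R) (J k : nat).

Definition layer D l : seq nat :=
  [seq p <- primes_upto (expR l) | (expR (l / 2) < p%:R) && (p \notin D)].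

(** The layers run downwards from [expR l], and layer [j] is truncated at level [k + 2 j]; steps of
    2 preserve the parity of [k]. The levels grow linearly while the logarithms of the primes shrink
    geometrically, which keeps the total degree bounded in terms of [l] and [k]. *)
Fixpoint layers D J l k : seq (seq nat * nat) :=
  if J is J'.+1 then (layer D l, k) :: layers D J' (l / 2) k.+2 else [::].

Definition layers_primes (ls : seq (seq nat * nat)) : seq nat :=
  flatten (map fst ls).

Fixpoint hooley_up y (ls : seq (seq nat * nat)) : R :=
  if ls is (s, k) :: ls' then hooley_up y ls' * bonf y k s else 1.

(** Hooley's telescoped lower bound. If [L <= P' <= U] for the lower layers and [b - e <= P <= b]
    for the top one, with [P'], [b] and [e] non-negative, then [P' P >= P' b - P' e >= L b - U e].
    Thus [L] may be negative. *)
Fixpoint hooley_lo y (ls : seq (seq nat * nat)) : R :=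
  if ls is (s, k) :: ls'
  then hooley_lo y ls' * bonf y k s - hooley_up y ls' * elem_sym y k.+1 s else 1.

Lemma mem_layer D l p : (p \in layer D l) =
  [&& expR (l / 2) < p%:R, p \notin D, prime p & p%:R <= expR l].
Proof. by rewrite mem_filter mem_primes_upto -andbA. Qed.

Lemma mem_layers_primes D J l k p : 0 <= l -> p \in layers_primes (layers D J l k) ->
  [&& p \notin D, prime p & p%:R <= expR l].
Proof.
elim: J l k => //= J IH l k l0; rewrite /layers_primes /= mem_cat => /orP[].
  by rewrite mem_layer => /andP[].
move=> /IH; case/(_ ltac:(lra))/and3P => -> -> pl /=.
by apply: le_trans pl _; rewrite ler_expR; lra.
Qed.

(** The condition on [J] says that [J] halvings bring [l] below [ln 2], so the layers exhaust the
    primes. *)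
Lemma layers_prod D J l k (F : nat -> R) : 0 <= l -> l < ln 2 * 2 ^+ J ->
  \prod_(p <- layers_primes (layers D J l k)) F p =
  \prod_(p <- primes_upto (expR l) | p \notin D) F p.
Proof.
elim: J l k => /= [|J IH] l k l0 lJ.
  rewrite primes_upto_lt2 ?big_nil // -[ltRHS]lnK ?posrE ?ltr_expR //.
  by rewrite mulr1 in lJ.
rewrite exprS in lJ; rewrite /layers_primes /= big_cat /= IH; [|lra..].
have ehalf : expR (l / 2) <= expR l by rewrite ler_expR; lra.
rewrite -(perm_big _ (primes_upto_filter _ _ ehalf)) /= !big_filter_cond /= mulrC.
rewrite [RHS](bigID (fun p => p%:R <= expR (l / 2))) /=; congr (_ * _).
  by apply: eq_bigl => p; rewrite -andbA [(p \notin D) && _]andbC.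
by apply: eq_bigl => p; rewrite -ltNge andbT -andbA [(p \notin D) && _]andbC.
Qed.

Lemma hooley_bounds y D J l k : ~~ odd k -> 0 <= l ->
  (forall p, prime p -> 0 <= y p <= 1) ->
  [/\ 0 <= \prod_(p <- layers_primes (layers D J l k)) (1 - y p),
      \prod_(p <- layers_primes (layers D J l k)) (1 - y p)
        <= hooley_up y (layers D J l k) &
      hooley_lo y (layers D J l k)
        <= \prod_(p <- layers_primes (layers D J l k)) (1 - y p)].
Proof.
move=> ek l0 y01; elim: J l k ek l0 => /= [|J IH] l k ek l0.
  by rewrite /layers_primes /= big_nil.
have [] := IH (l / 2) k.+2; rewrite /= ?negbK // ?divr_ge0 //.
rewrite /layers_primes /= big_cat /=.
have yl : {in layer D l, forall p, 0 <= y p <= 1}.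
  by move=> p; rewrite mem_layer => /and4P[_ _ pp _]; apply: y01.
have := bonf_even_ge _ _ _ ek yl; have := bonf_even_le _ _ _ ek yl.
have : 0 <= elem_sym y k.+1 (layer D l).
  by apply: elem_sym_ge0 => p /yl/andP[].
have : 0 <= \prod_(p <- layer D l) (1 - y p).
  by apply: prodr_ge0_seq => p /yl; lra.
set P := \prod_(p <- layer D l) _; set P' := \prod_(p <- flatten _) _.
set b := bonf _ _ _; set e := elem_sym _ _ _.
set U := hooley_up _ _; set L := hooley_lo _ _ => h1 h2 h3 h4 h5 h6 h7.
have b0 : 0 <= b by lra.
split.
- exact: mulr_ge0.
- by rewrite mulrC; apply: ler_pM.
- have a1 : L * b <= P' * b by rewrite ler_wpM2r.
  have a2 : P' * e <= U * e by rewrite ler_wpM2r.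
  have a3 : P' * (b - e) <= P' * P by rewrite ler_wpM2l.
  by rewrite mulrC; move: a3; rewrite mulrBr; lra.
Qed.

(** The top layer loses a proportion [2^-k], and the levels grow by 2. By induction the lower layers
    lose at most [2 * 2^-(k+2)], and the total stays below [2 * 2^-k]. *)
Lemma hooley_lo_ge y D J l k : ~~ odd k -> 0 <= l ->
  (forall p, prime p -> 0 <= y p <= 1) ->
  (forall l' k', 0 <= l' -> (k <= k')%N -> ~~ odd k' ->
     elem_sym y k'.+1 (layer D l') <= (2 ^+ k')^-1 * bonf y k' (layer D l')) ->
  (1 - 2 * (2 ^+ k)^-1) * hooley_up y (layers D J l k)
    <= hooley_lo y (layers D J l k).
Proof.
move=> ek l0 y01; elim: J l k ek l0 => /= [|J IH] l k ek l0 H.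
  by rewrite mulr1 gerBl mulr_ge0 // invr_ge0 exprn_ge0.
have ek2 : ~~ odd k.+2 by rewrite /= negbK.
have l20 : 0 <= l / 2 by lra.
have IH1 : (1 - 2 * (2 ^+ k.+2)^-1) * hooley_up y (layers D J (l / 2) k.+2)
    <= hooley_lo y (layers D J (l / 2) k.+2).
  apply: IH => // l' k' l'0 kk; apply: H => //; by apply: leq_trans kk; lia.
have [h4 h5 _] := hooley_bounds y D J (l / 2) k.+2 ek2 l20 y01.
have yl : {in layer D l, forall p, 0 <= y p <= 1}.
  by move=> p; rewrite mem_layer => /and4P[_ _ pp _]; apply: y01.
have h3 := bonf_even_ge _ _ _ ek yl.
have h1 : 0 <= \prod_(p <- layer D l) (1 - y p).
  by apply: prodr_ge0_seq => p /yl; lra.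
have := H l k l0 (leqnn _) ek.
move: IH1 (le_trans h4 h5) (le_trans h1 h3); rewrite !exprS.
have t0 : 0 <= (2 ^+ k)^-1 :> R by rewrite invr_ge0 exprn_ge0.
have -> : (2 * (2 * 2 ^+ k))^-1 = (2 ^+ k)^-1 / 4 :> R.
  by field; rewrite expf_neq0 // pnatr_eq0.
move: t0; move: (2 ^+ k)^-1 => t t0.
set U := hooley_up _ _; set L := hooley_lo _ _; set b := bonf _ _ _; set e := elem_sym _ _ _.
move=> a1 U0 b0 a2.
have := ler_wpM2r b0 a1; have := ler_wpM2l U0 a2.
have := mulr_ge0 (mulr_ge0 U0 b0) t0.
nra.
Qed.

(** The top layer has degree at most [k + 1] in primes up to [expR l], and the exponent
    [l (2 k + 6)] solves the resulting recursion: [(l/2) (2 (k+2) + 6) + l (k+1) = l (2 k + 6)]. The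
    weights of [bonf] at level [k] and of the correction of degree [k + 1] together form one
    truncated expansion, hence the common bound by [w]. *)
Lemma layers_sifted {A : Type} (X : seq A) (g : A -> R) (ind : nat -> A -> R)
    (eta : nat -> R) (M E Y theta : R) D J l k :
  0 <= E -> 0 <= theta <= 1 -> 0 <= l ->
  sifted X g ind eta M E Y D (fun=> 1) 1 1 1 ->
  let ls := layers D J l k in
  let B := layers_primes ls ++ D in
  let w := \prod_(p <- layers_primes ls) (1 + (p%:R ^+ 2)^-1) in
  let Q := expR (l * (2 * k + 6)%:R) in
  sifted X g ind eta M E Y B (fun x => hooley_up (fun p => theta * ind p x) ls)
    (hooley_up (fun p => theta * eta p) ls) w Q /\
  sifted X g ind eta M E Y B (fun x => hooley_lo (fun p => theta * ind p x) ls)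
    (hooley_lo (fun p => theta * eta p) ls) w Q.
Proof.
move=> E0 th01 l0 H; elim: J l k l0 => [|J IH] l k l0 /=.
  rewrite /layers_primes /= big_nil.
  by split; apply: sifted_mono H => //; rewrite -[leLHS]expR0 ler_expR mulr_ge0.
have /andP[th0 th1] := th01.
have := IH (l / 2) k.+2 ltac:(lra); move: (mem_layers_primes D J (l / 2) k.+2).
rewrite /layers_primes /= => mls [/= hu hl].
set fl := flatten _ in mls hu hl *.
set s := layer D l.
have sP : all prime s by apply/allP => p; rewrite mem_layer => /and4P[].
have su : uniq s by apply: filter_uniq; apply: primes_upto_uniq.
have sB : all (fun p => p \notin fl ++ D) s.
  apply/allP => p; rewrite mem_layer mem_cat negb_or => /and4P[pl -> _ _].
  rewrite andbT; apply/negP => /mls; case/(_ ltac:(lra))/and3P => _ _.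
  by rewrite leNgt pl.
have sz : all (fun p => p%:R <= expR l) s.
  by apply/allP => p; rewrite mem_layer => /and4P[].
have z1 : 1 <= expR l by rewrite -expR0 ler_expR.
have s0 : {in s, forall p, 0 <= theta / p%:R ^+ 2 :> R}.
  by move=> p _; rewrite divr_ge0 ?sqr_ge0.
have ws : \sum_(i < k.+2) elem_sym (fun p => theta / p%:R ^+ 2) i s
    <= \prod_(p <- s) (1 + (p%:R ^+ 2)^-1) :> R.
  apply: le_trans (sum_elem_sym_le _ _ _ s0) _; apply: ler_prod_seq => p ps _.
  rewrite addr_ge0 ?s0 //= lerD2l -[leRHS]mul1r ler_wpM2r // invr_ge0 sqr_ge0 //.
have ek0 : 0 <= elem_sym (fun p => theta / p%:R ^+ 2) k.+1 s :> R by apply: elem_sym_ge0.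
rewrite big_ord_recr /= in ws.
rewrite big_cat /=; set W := \prod_(p <- fl) _ in hu hl *.
set Ws := \prod_(p <- s) _ in ws *.
have W0 : 0 <= W by apply: prodr_ge0 => p _; rewrite addr_ge0 // invr_ge0 sqr_ge0.
set q := expR _ in hu hl; have q0 : 0 <= q by apply: expR_ge0.
have bu := sifted_bonf _ _ _ _ _ _ _ _ E0 th01 _ _ _ _ _ _ _ k q0 z1 su sP sB sz hu.
have bl := sifted_bonf _ _ _ _ _ _ _ _ E0 th01 _ _ _ _ _ _ _ k q0 z1 su sP sB sz hl.
have eu := sifted_elem_sym _ _ _ _ _ _ _ _ E0 th01 _ _ _ _ _ _ _ k.+1 q0 z1 su sP sB sz hu.
have qz : q * expR l ^+ k.+1 = expR (l * (2 * k + 6)%:R).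
  rewrite /q -expRM_natr -expRD; congr expR; rewrite !natrD !natrM.
  have -> : k.+2%:R = k%:R + 2 :> R by rewrite -natrD addn2.
  have -> : k.+1%:R = k%:R + 1 :> R by rewrite natr1.
  by field.
have qzk : q * expR l ^+ k <= expR (l * (2 * k + 6)%:R).
  by rewrite -qz ler_wpM2l // ler_weXn2l.
have sub : {subset s ++ (fl ++ D) <= (s ++ fl) ++ D} by move=> p; rewrite catA.
split.
  apply: (sifted_mono _ _ _ _ _ _ _ E0 _ _ _ _ _ _ _ _ sub _ qzk bu).
  rewrite mulrC ler_wpM2r //; lra.
rewrite -qz in qzk *.
have eu' := siftedZ _ _ _ _ _ _ _ (-1) _ _ _ _ _ eu.
have bl' := sifted_mono _ _ _ _ _ _ _ E0 _ _ _ _ _ _ _ _ (fun p => id) (lexx _) qzk bl.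
apply: (sifted_mono _ _ _ _ _ _ _ E0 _ _ _ _ _ _ _ _ sub _ (lexx _)); last first.
  apply: eq_sifted (siftedD _ _ _ _ _ _ _ _ _ _ _ _ _ _ _ bl' eu') => [x||] /=.
  - by rewrite mulN1r.
  - by rewrite mulN1r.
  - reflexivity.
rewrite normrN1 mul1r -mulrDr mulrC ler_wpM2r //.
Qed.

End BrunHooley.

(** With [u = 1 - (1 - 1/alpha) t >= 1/alpha], one has [ln u >= 1 - 1/u = - (1 - u) / u]. Here
    [1/u <= alpha] and [1 - u <= t]. *)
Lemma expR_le_1sub {R : realType} (alpha t : R) : 1 < alpha -> 0 <= t <= 1 ->
  expR (- (alpha * t)) <= 1 - (1 - alpha^-1) * t.
Proof.
move=> a1 /andP[t0 t1]; set u := 1 - _.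
have ai : alpha * alpha^-1 = 1 by rewrite divff // gt_eqF //; lra.
have ai0 : 0 < alpha^-1 by rewrite invr_gt0; lra.
have u0 : alpha^-1 <= u by rewrite /u; nra.
have u1 : 0 < u by lra.
apply: le_trans (expR_sub1V_le _ _ u1); rewrite ler_expR.
have uV : u * u^-1 = 1 by rewrite divff // gt_eqF.
have ui : u^-1 <= alpha by rewrite -[leRHS]invrK lef_pV2 ?posrE.
have ui0 : 0 < u^-1 by rewrite invr_gt0.
have e : 1 - u = (1 - alpha^-1) * t by rewrite /u; ring.
have h : 1 - u^-1 = - ((1 - u) * u^-1) by rewrite mulrBl uV mul1r; ring.
rewrite h e lerN2 mulrAC -subr_ge0.
have : (1 - alpha^-1) * u^-1 <= alpha by nra.
nra.
Qed.

Lemma exists_pow2_gt {R : realType} (x : R) : exists n, x < 2 ^+ n.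
Proof.
exists (Num.truncn x).+1; apply: lt_le_trans (truncnS_gt _) _.
by rewrite -natrX ler_nat ltnW // ltn_expl.
Qed.

(** * The sieve lower bound with a general weight *)

Section Sieve.
Context {R : realType}.

(** The level [k] comes from [alpha] and [L] alone, before the sieving range, so that the range can
    later be shrunk until the degree [l (2 k + 6)] is admissible. The weight [g] will be the
    indicator of a divisor condition, and the primes of that divisor, listed in [D], are left
    unsieved. *)
Lemma sieve_lower_bound (alpha L : R) : 1 < alpha -> 0 <= L ->
  exists k : nat, forall (A : Type) (X : seq A) (g : A -> R) (ind : nat -> A -> R)
    (eta : nat -> R) (M E l : R) (D : seq nat),
  0 <= M -> 0 <= E -> 0 <= l ->
  (forall p, prime p -> 0 <= eta p <= 1) ->
  (forall l' : R, 0 <= l' ->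
     \sum_(p <- primes_upto (expR l') | expR (l' / 2) < p%:R) eta p <= L) ->
  (forall x, 0 <= g x) -> (forall p x, 0 <= ind p x <= 1) ->
  (forall D', uniq D' -> all prime D' -> all (fun p => p \notin D) D' ->
     nprod D' <= expR (l * (2 * k + 6)%:R) :> R ->
     `| \sum_(x <- X) g x * \prod_(p <- D') ind p x
        - M * \prod_(p <- D') eta p | <= E) ->
  M / 2 * \prod_(p <- primes_upto (expR l) | p \notin D) (1 - (1 - alpha^-1) * eta p)
    - E * expR 2 * expR (l * (2 * k + 6)%:R) ^+ 2
  <= \sum_(x <- X) g x *
       \prod_(p <- primes_upto (expR l) | p \notin D) (1 - (1 - alpha^-1) * ind p x).
Proof.
move=> a1 L0.
(* At a level [k' >= k], the degree [k' + 1] term is at most [L^(k'+1) / (k'+1)! <= 4^-(k'+1) expR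
   (4 L)], while the Bonferroni sum is at least [expR (- alpha L)]. The choice of [n] makes the
   ratio at most [2^-k']. *)
have [n hn] := exists_pow2_gt (expR ((4 + alpha) * L)).
exists (2 * n.+1)%N => A X g ind eta M E l D M0 E0 l0 eta01 HL g0 ind01 base.
set theta := 1 - alpha^-1.
set k := (2 * n.+1)%N in base *; set Y := expR _ in base *.
have ai0 : 0 < alpha^-1 by rewrite invr_gt0; lra.
have ai1 : alpha^-1 < 1 by rewrite invf_lt1; lra.
have th01 : 0 <= theta <= 1 by rewrite /theta; lra.
have [th0 th1] := andP th01.
have ek : ~~ odd k by rewrite /k mul2n odd_double.
have k2 : expR ((4 + alpha) * L) <= 2 ^+ k.
  by apply: (le_trans (ltW hn)); rewrite ler_weXn2l // /k; [lra|lia].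
have k4 : 4 <= 2 ^+ k :> R.
  have -> : 4 = 2 ^+ 2 :> R by rewrite expr2; lra.
  by rewrite ler_weXn2l // /k; [lra|lia].
have Y1 : 1 <= Y by rewrite /Y -expR0 ler_expR mulr_ge0.
have [J hJ] := exists_pow2_gt (l / ln 2).
have {}hJ : l < ln 2 * 2 ^+ J by rewrite mulrC -ltr_pdivrMr // ln2_gt0.
(* The uniform error [E] fits the scaled form because [nprod D' <= Y]. *)
have sif1 : sifted X g ind eta M E Y D (fun=> 1) 1 1 1.
  move=> D' uD pD DD; rewrite mulr1 mul1r => DY.
  have D'0 : 0 < nprod D' :> R by apply: nprod_gt0.
  rewrite [X in `|X - _|](eq_bigr (fun x => g x * \prod_(p <- D') ind p x)); last first.
    by move=> x _; rewrite mulr1.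
  apply: (le_trans (base D' uD pD DD DY)).
  rewrite mulr1 ler_peMr // exprn_ege1 // ler_pdivlMr // mul1r //.
have [_ hlo] := layers_sifted X g ind eta M E Y theta D J l k E0 th01 l0 sif1.
set ls := layers D J l k in hlo.
(* The empty list gives the plain weighted sum, at the price of the scale [Y^2] in the error. *)
have {}hlo := hlo [::] isT isT isT.
rewrite /nprod !big_nil mul1r in hlo; have {hlo} := hlo (lexx _).
rewrite divr1 mulr1 (eq_bigr (fun x => g x * hooley_lo (fun p => theta * ind p x) ls));
  last by move=> x _; rewrite big_nil mulr1.
set w := \prod_(p <- layers_primes ls) _.
have yeta p : prime p -> 0 <= theta * eta p <= 1.
  by move=> pp; have /andP[e0 e1] := eta01 _ pp; rewrite mulr_ge0 //= mulr_ile1.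
have w2 : w <= expR 2.
  rewrite /w layers_prod // -[2]mulr1.
  apply: le_trans (prod1D_inv_sqr_le (expR l) 1 ler01).
  rewrite [leRHS](prod_filterC _ (fun p => p \notin D)) /=.
  rewrite (eq_bigr (fun p => 1 + 1 / p%:R ^+ 2)); last by move=> p _; rewrite div1r.
  have P0 : 0 <= \prod_(p <- primes_upto (expR l) | p \notin D) (1 + 1 / p%:R ^+ 2) :> R.
    by apply: prodr_ge0 => p _; rewrite addr_ge0 // divr_ge0 ?sqr_ge0.
  rewrite ler_peMr //; apply: prodr_ge1_seq => p _ _.
  by rewrite lerDl div1r invr_ge0 sqr_ge0.
have Hr (l' : R) k' : 0 <= l' -> (k <= k')%N -> ~~ odd k' ->
    elem_sym (fun p => theta * eta p) k'.+1 (layer D l')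
    <= (2 ^+ k')^-1 * bonf (fun p => theta * eta p) k' (layer D l').
  move=> l'0 kk ek'.
  have lay p : p \in layer D l' -> prime p by rewrite mem_layer => /and4P[].
  have SL : \sum_(p <- layer D l') eta p <= L.
    apply: le_trans (HL _ l'0); rewrite big_filter.
    rewrite [leRHS](bigID (fun p => p \notin D)) /= lerDl.
    apply: sumr_ge0_seq => p; rewrite mem_primes_upto => /andP[pp _] _.
    by have /andP[] := eta01 _ pp.
  have bge : expR (- (alpha * L)) <= bonf (fun p => theta * eta p) k' (layer D l').
    apply: le_trans (bonf_even_ge _ _ _ ek' _); last by move=> p /lay/yeta.
    apply: (@le_trans _ _ (\prod_(p <- layer D l') expR (- (alpha * eta p)))).
      rewrite -expR_sum ler_expR sumrN -big_distrr /= lerN2 ler_wpM2l //; lra.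
    apply: ler_prod_seq => p /lay pp _; rewrite expR_ge0 /=.
    by apply: expR_le_1sub => //; apply: eta01.
  have S0 : 0 <= \sum_(p <- layer D l') theta * eta p.
    by apply: sumr_ge0_seq => p /lay/yeta/andP[].
  have SL' : \sum_(p <- layer D l') theta * eta p <= L.
    apply: le_trans SL; apply: ler_sum_seq => p /lay/eta01/andP[e0 _] _.
    by rewrite ler_piMl.
  apply: (le_trans (elem_sym_le_expn _ _ _ _)); first by move=> p /lay/yeta/andP[].
  apply: (@le_trans _ _ (L ^+ k'.+1 / (k'.+1)`!%:R)).
    by rewrite ler_wpM2r ?invr_ge0 // lerXn2r ?nnegrE.
  have := @expR_ge1Dxn R (4 * L) k' ltac:(lra); rewrite exprMn -mulrA => hx.
  apply: (@le_trans _ _ ((2 ^+ k')^-1 * expR (- (alpha * L)))); last first.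
    by rewrite ler_wpM2l // invr_ge0 exprn_ge0.
  have k2' : expR ((4 + alpha) * L) <= 2 ^+ k'.
    by apply: (le_trans k2); rewrite ler_weXn2l //; lra.
  have f0 : 0 <= L ^+ k'.+1 / (k'.+1)`!%:R by rewrite divr_ge0 ?exprn_ge0.
  rewrite [leRHS]mulrC expRN ler_pdivlMr ?exprn_gt0 //.
  move: hx f0 k2'; rewrite [4 ^+ _]exprS.
  have -> : 4 ^+ k' = 2 ^+ k' * 2 ^+ k' :> R by rewrite -exprMn; congr (_ ^+ _); lra.
  rewrite [(4 + _) * _]mulrDl expRD.
  have t0 : 0 < 2 ^+ k' :> R by rewrite exprn_gt0.
  move: (expR_gt0 (4 * L)) (expR_gt0 (alpha * L)).
  move: (expR (4 * L)) (expR (alpha * L)) (2 ^+ k') (L ^+ k'.+1 / _) t0 => a b t f t0 a0 b0 hx f0 hab.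
  have : 4 * t * t * f * b <= t.
    by apply: le_trans hab; rewrite ler_wpM2r ?ltW //; lra.
  have -> : 4 * t * t * f * b = t * (4 * (t * f * b)) by ring.
  rewrite -[leRHS]mulr1 ler_pM2l // => h4.
  rewrite -[leRHS]div1r ler_pdivlMr // [f * t]mulrC; have : 0 <= t * f * b by rewrite !mulr_ge0 // ltW.
  lra.
have [h1 h2 _] := hooley_bounds (fun p => theta * eta p) D J l k ek l0 yeta.
have h3 := hooley_lo_ge (fun p => theta * eta p) D J l k ek l0 yeta Hr.
have : 1 / 2 * \prod_(p <- primes_upto (expR l) | p \notin D) (1 - theta * eta p)
    <= hooley_lo (fun p => theta * eta p) ls.
  apply: le_trans h3; rewrite -(layers_prod D J l k) //.
  apply: ler_pM => //; have : (2 ^+ k)^-1 <= 4^-1 :> R by rewrite lef_pV2 ?posrE //; lra.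
  lra.
rewrite ler_norml => hlo /andP[hs _].
have : \sum_(x <- X) g x * hooley_lo (fun p => theta * ind p x) ls <=
   \sum_(x <- X) g x *
       \prod_(p <- primes_upto (expR l) | p \notin D) (1 - theta * ind p x).
  apply: ler_sum => x _; rewrite ler_wpM2l // -(layers_prod D J l k) //.
  have yx p : prime p -> 0 <= theta * ind p x <= 1.
    by move=> _; have /andP[e0 e1] := ind01 p x; rewrite mulr_ge0 //= mulr_ile1.
  by have [] := hooley_bounds (fun p => theta * ind p x) D J l k ek l0 yx.
apply: le_trans.
have := ler_wpM2l M0 hlo.
have : E * w * Y ^+ 2 <= E * expR 2 * Y ^+ 2.
  by rewrite ler_wpM2r ?sqr_ge0 // ler_wpM2l.
lra.
Qed.

End Sieve.

(** * Lists of distinct primes and squarefree integers *)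

Section SquarefreeProducts.
Implicit Types (D : seq nat).

Lemma prod_primes_gt0 D : all prime D -> (0 < \prod_(p <- D) p)%N.
Proof.
by move=> /allP pD; rewrite big_seq; apply: prodn_cond_gt0 => p /pD/prime_gt0.
Qed.

Lemma logn_prod_primes D q : uniq D -> all prime D ->
  logn q (\prod_(p <- D) p) = (q \in D).
Proof.
elim: D => [|p D IH] /=; first by rewrite big_nil logn1.
case/andP=> pD uD /andP[pp aD]; rewrite big_cons.
rewrite (lognM _ (prime_gt0 pp) (prod_primes_gt0 _ aD)).
by rewrite logn_prime // IH // inE; case: eqP => [->|//]; rewrite (negbTE pD).
Qed.

Lemma mem_primes_prod D : all prime D -> primes (\prod_(p <- D) p) =i D.
Proof.
elim: D => [|p D IH] /=; first by rewrite big_nil.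
case/andP=> pp aD q; rewrite big_cons.
rewrite (primesM _ (prime_gt0 pp) (prod_primes_gt0 _ aD)) IH //.
by rewrite primes_prime // !inE.
Qed.

Lemma squarefree_prod D : uniq D -> all prime D -> squarefree (\prod_(p <- D) p).
Proof.
move=> uD aD; rewrite /squarefree prod_primes_gt0 //=; apply/allP => q _.
by rewrite logn_prod_primes // leq_b1.
Qed.

Lemma coprime_prod_primes D D' : uniq (D ++ D') -> all prime D -> all prime D' ->
  coprime (\prod_(p <- D) p) (\prod_(p <- D') p).
Proof.
rewrite cat_uniq => /and3P[_ dis _] aD aD'.
rewrite coprime_has_primes ?prod_primes_gt0 //; apply/hasPn => q.
rewrite !mem_primes_prod // => qD'; apply/negP => qD.
by move/hasPn: dis => /(_ q qD'); rewrite qD.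
Qed.

Lemma mult01_prod {R : realType} (eta : nat -> R) D : mult01 eta -> uniq D ->
  all prime D -> eta (\prod_(p <- D) p)%N = \prod_(p <- D) eta p.
Proof.
move=> [eta1 [etaM _]]; elim: D => [|p D IH]; first by rewrite !big_nil.
move=> uD /andP[pp aD]; rewrite !big_cons.
rewrite (etaM _ _ (prime_gt0 pp) (prod_primes_gt0 _ aD)).
  by rewrite IH //; case/andP: uD.
have := coprime_prod_primes [:: p] D uD; rewrite big_seq1 /= pp; exact.
Qed.

End SquarefreeProducts.

(** * Sign indicators and the weight as a finite product *)

Section SignIndicators.
Context {R : realType} {A : eqType}.
Implicit Types (f : nat -> A -> int) (x : A) (alpha z : R) (e : int).

Definition sign_ind f e (p : nat) x : R := (f p x == e)%:R.

Lemma sign_ind01 f e p x : 0 <= sign_ind f e p x <= 1.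
Proof. by rewrite /sign_ind; case: eqP => _ /=; rewrite ?lexx ?ler01. Qed.

Lemma prod_sign_ind f e D x :
  \prod_(p <- D) sign_ind f e p x = (all (fun p => f p x == e) D)%:R.
Proof.
elim: D => [|p D IH]; first by rewrite big_nil.
by rewrite big_cons IH /sign_ind -natrM mulnb.
Qed.

Lemma count_signE (AN : seq A) f Dm Dp : all prime Dm -> all prime Dp ->
  (count_sign AN f (\prod_(p <- Dm) p) (\prod_(p <- Dp) p))%:R =
  \sum_(x <- AN) \prod_(p <- Dp) sign_ind f 1 p x * \prod_(p <- Dm) sign_ind f (-1) p x.
Proof.
move=> am ap; rewrite /count_sign size_filter -sum1_count natr_sum big_mkcond /=.
apply: eq_bigr => x _; rewrite !prod_sign_ind -natrM mulnb andbC.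
rewrite !(eq_all_r (mem_primes_prod _ _)) //.
by case: (_ && _).
Qed.

(** This turns the hypothesis on coprime squarefree pairs into one on disjoint lists of primes, the
    form needed for the expansions. *)
Lemma count_estimate (AN : seq A) f (etap etam : nat -> R) (K Y : R) Dm Dp :
  mult01 etap -> mult01 etam -> (0 < size AN)%N ->
  (forall qm qp : nat, squarefree qm -> squarefree qp -> coprime qm qp ->
    (qm * qp)%N%:R <= Y ->
    `| (count_sign AN f qm qp)%:R / (size AN)%:R - etam qm * etap qp | <= K) ->
  uniq (Dm ++ Dp) -> all prime Dm -> all prime Dp -> nprod Dm * nprod Dp <= Y ->
  `| \sum_(x <- AN) \prod_(p <- Dp) sign_ind f 1 p x *
       \prod_(p <- Dm) sign_ind f (-1) p x
     - (size AN)%:R * \prod_(p <- Dp) etap p * \prod_(p <- Dm) etam p |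
  <= (size AN)%:R * K.
Proof.
move=> mp mm sA H uD am ap DY.
have sA0 : 0 < (size AN)%:R :> R by rewrite ltr0n.
have [um up] : uniq Dm /\ uniq Dp by move: uD; rewrite cat_uniq => /and3P[].
have := H (\prod_(p <- Dm) p)%N (\prod_(p <- Dp) p)%N (squarefree_prod _ um am)
  (squarefree_prod _ up ap) (coprime_prod_primes _ _ uD am ap).
rewrite natrM !natr_prod => /(_ DY); rewrite count_signE // !mult01_prod //.
rewrite -(ler_pM2l sA0) -{1}[(size AN)%:R](@ger0_norm R) // -normrM.
set S := \sum_(x <- _) _; move=> h; apply: le_trans h; rewrite le_eqVlt; apply/orP; left.
by apply/eqP; congr (`|_|); field; rewrite gt_eqF.
Qed.

Lemma exprz_sign_ind alpha f p x : 1 < alpha -> f p x \in [:: -1; 0; 1] ->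
  alpha ^ (f p x) =
  (1 + (alpha - 1) * sign_ind f 1 p x) * (1 - (1 - alpha^-1) * sign_ind f (-1) p x).
Proof.
move=> a1; rewrite /sign_ind !inE => /or3P[] /eqP -> /=.
- by rewrite exprN1; ring.
- by rewrite expr0z; ring.
- by rewrite expr1z; ring.
Qed.

Lemma supp_le f x z p : (forall n, partial_supp_prod f x n <= z) -> prime p ->
  f p x != 0 -> p%:R <= z.
Proof.
move=> h pp fp; apply: le_trans (h p.+1); rewrite /partial_supp_prod.
rewrite big_mkcond big_ord_recr /= pp fp ler_peMl //.
apply: prodr_ge1_seq => i _ _; case: ifP => // /andP[ip _].
by rewrite ler1n prime_gt0.
Qed.

Lemma supp_prod_le f x z : (forall n, partial_supp_prod f x n <= z) ->
  \prod_(p <- primes_upto z | f p x != 0) p%:R <= z.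
Proof.
move=> h; apply: le_trans (h (Num.truncn z).+1); rewrite big_filter_cond.
by rewrite /partial_supp_prod -(big_mkord (fun p => prime p && (f p x != 0))) /index_iota subn0.
Qed.

(** Every prime with [f p x] non-zero divides a product bounded by [z], so it is at most [z]; the
    partial products are constant from there on and the limit is attained. *)
Lemma euler_weightE alpha f x z : (forall n, partial_supp_prod f x n <= z) ->
  euler_weight alpha f x = \prod_(p <- primes_upto z) alpha ^ (f p x).
Proof.
move=> h; rewrite /euler_weight; apply: norm_lim_near_cst.
exists (Num.truncn z).+1 => // n /= zn.
rewrite /partial_weight -(big_mkord prime (fun p => alpha ^ (f p x))) /index_iota subn0 big_filter.
rewrite -(subnKC zn) iotaD big_cat /= [X in _ * X]big_seq_cond [X in _ * X]big1 ?mulr1 //.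
move=> p; rewrite mem_iota add0n => /andP[/andP[zp _] pp].
suff -> : f p x = 0 by rewrite expr0z.
apply/eqP/negPn/negP => fp; have pz := supp_le _ _ _ _ h pp fp.
move: zp; rewrite ltnNge => /negP; apply; rewrite truncn_ge_nat //.
by apply: le_trans pz.
Qed.

End SignIndicators.

(** * The pointwise bound by truncated divisor sums *)

Section Pointwise.
Context {R : realType}.
Implicit Types (s a b S : seq nat) (t u Q z l : R).

(** Each prime contributes more than [t] to the logarithm of the product. *)
Lemma size_large_primes_le s t u : all (fun p => expR t < p%:R) s ->
  nprod s <= expR u -> (size s)%:R * t <= u.
Proof.
move=> /allP st su; rewrite -ler_expR; apply: le_trans su.
rewrite -sum1_size natr_sum big_distrl /= expR_sum; apply: ler_prod_seq => p /st pt _.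
by rewrite mul1r expR_ge0 ltW.
Qed.

Lemma prefix_split s Q : all prime s -> 1 <= Q ->
  nprod s <= Q \/ exists a q b,
    [/\ s = a ++ q :: b, nprod a <= Q & Q < nprod a * q%:R].
Proof.
elim: s Q => [|p s IH] Q /=; first by rewrite /nprod big_nil; left.
case/andP=> pp ps Q1; have p0 : 0 < p%:R :> R by rewrite ltr0n prime_gt0.
have [pQ|Qp] := leP p%:R Q; last first.
  by right; exists [::], p, s; rewrite /nprod big_nil mul1r.
have [|h|[a [q [b [-> h1 h2]]]]] := IH (Q / p%:R) ps; first by rewrite ler_pdivlMr // mul1r.
  by left; rewrite /nprod big_cons mulrC -ler_pdivlMr.
right; exists (p :: a), q, b; rewrite /nprod !big_cons; split => //.
  by rewrite mulrC -ler_pdivlMr.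
by rewrite -mulrA mulrC -ltr_pdivrMr.
Qed.

Lemma dyadic_find J t l : t <= l -> l / 2 ^+ J < t ->
  exists2 j, (j < J)%N & l / 2 ^+ j.+1 < t <= l / 2 ^+ j.
Proof.
elim: J => [|J IH] tl lt; first by move: lt; rewrite expr0 divr1 ltNge tl.
have [h|h] := leP t (l / 2 ^+ J); first by exists J => //; rewrite lt.
by have [j jJ hj] := IH tl h; exists j => //; rewrite ltnS ltnW.
Qed.

Lemma subseq_primes_upto s z : sorted ltn s -> all prime s ->
  all (fun p => p%:R <= z) s -> subseq s (primes_upto z).
Proof.
move=> ss ps sz; suff -> : s = [seq p <- primes_upto z | p \in s] by apply: filter_subseq.
apply: (irr_sorted_eq ltn_trans ltnn) => //.
  by apply: sorted_filter; [exact: ltn_trans|exact: primes_upto_sorted].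
move=> p; rewrite mem_filter mem_primes_upto; case ps': (p \in s) => //=.
by rewrite (allP ps) // (allP sz).
Qed.

Lemma powR_expn (alpha : R) n : 0 < alpha -> alpha ^+ n = alpha `^ n%:R.
Proof. by move=> a0; rewrite powR_mulrn // ltW. Qed.

Lemma powR_prime_ge1 (p : nat) (k : R) : prime p -> 0 <= k -> 1 <= p%:R `^ k.
Proof.
by move=> pp k0; rewrite -[leLHS](powRr0 p%:R) ler_powR // ler1n prime_gt0.
Qed.

(* [a] is the longest prefix of [S] with product at most [Q = expR (2 d l)].
   When the next prime is small, [a] is a large smooth number, and Rankin's trick
   at the dyadic scale of that prime pays for the primes beyond [a]. *)
Lemma expn_size_le_subsums (alpha d C l K Q : R) S J : 1 < alpha -> 0 < d -> 0 <= C ->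
  0 < l -> sorted ltn S -> all prime S -> nprod S <= expR (C * l) ->
  d * l / 2 ^+ J < ln 2 ->
  K = 2 * C * ln alpha / d + 1 -> Q = expR (2 * d * l) ->
  alpha ^+ size S <=
    alpha `^ (C / d) *
      subsum (primes_upto Q) Q (fun p => (alpha * p%:R `^ 0 - 1) * (p \in S)%:R)
    + \sum_(j < J) (2 ^+ j)^-1 *
      subsum (primes_upto (expR (d * l / 2 ^+ j))) Q
        (fun p => (alpha * p%:R `^ (K * 2 ^+ j / (d * l)) - 1) * (p \in S)%:R).
Proof.
move=> a1 d0 C0 l0 sS pS SC hJ -> -> {K Q}.
set K := 2 * C * ln alpha / d + 1; set Q := expR (2 * d * l).
have dl0 : 0 < d * l by rewrite mulr_gt0.
have a0 : 0 <= alpha by lra.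
have la0 : 0 <= ln alpha by apply: ln_ge0; lra.
have K0 : 0 <= K by rewrite /K addr_ge0 // divr_ge0 ?mulr_ge0 // ltW.
have w0 z k : 0 <= k -> {in primes_upto z, forall p : nat,
    0 <= (alpha * p%:R `^ k - 1) * (p \in S)%:R}.
  move=> k0 p; rewrite mem_primes_upto => /andP[pp _]; rewrite mulr_ge0 //.
  have := powR_prime_ge1 p k pp k0; nra.
have sub0 z k : 0 <= k -> 0 <= subsum (primes_upto z) Q
    (fun p => (alpha * p%:R `^ k - 1) * (p \in S)%:R).
  move=> k0; apply: sumr_ge0_seq => D sD _; apply: subseqs_prod_ge0 sD; exact: w0.
(* One plus the weight is [alpha * p^k] for [p] in [S], so the product over [a] is [alpha^|a|] times
   [(nprod a)^k], and no divisor of [a] is cut off. *)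
have key z k a : 0 <= k -> subseq a S -> nprod a <= Q -> all (fun p => p%:R <= z) a ->
    alpha ^+ size a * nprod a `^ k <=
    subsum (primes_upto z) Q (fun p => (alpha * p%:R `^ k - 1) * (p \in S)%:R).
  move=> k0 aS aQ az.
  have sa : sorted ltn a by apply: subseq_sorted sS; [exact: ltn_trans|].
  have pa : all prime a by apply/allP => p pa; apply: (allP pS); apply: (mem_subseq aS).
  have := prod_le_subsum a (primes_upto z) Q _ (w0 z k k0) pa
    (subseq_primes_upto _ _ sa pa az) aQ.
  apply: le_trans; rewrite nprod_powR.
  have -> : alpha ^+ size a = \prod_(p <- a) alpha.
    by rewrite big_const_seq count_predT iter_mulr_1.
  rewrite -big_split /=; apply: ler_prod_seq => p pa' _.
  rewrite (mem_subseq aS pa') mulr1 addrCA subrr addr0 lexx andbT.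
  by rewrite mulr_ge0 ?powR_ge0 //; lra.
have kj0 j : 0 <= K * 2 ^+ j / (d * l) by rewrite divr_ge0 ?mulr_ge0 ?exprn_ge0 // ltW.
have Q1 : 1 <= Q by rewrite /Q -expR0 ler_expR !mulr_ge0 // ltW.
have sum0 : 0 <= \sum_(j < J) (2 ^+ j)^-1 *
      subsum (primes_upto (expR (d * l / 2 ^+ j))) Q
        (fun p => (alpha * p%:R `^ (K * 2 ^+ j / (d * l)) - 1) * (p \in S)%:R).
  apply: sumr_ge0 => j _; rewrite mulr_ge0 ?invr_ge0 ?exprn_ge0 //.
  exact: sub0.
(* If all the primes beyond [a] exceed [expR (d * l)], there are at most [C / d] of them, and no
   Rankin weight is needed: [k = 0]. *)
have head a b : S = a ++ b -> nprod a <= Q -> all (fun p => expR (d * l) < p%:R) b ->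
    alpha ^+ size S <= alpha `^ (C / d) *
      subsum (primes_upto Q) Q (fun p => (alpha * p%:R `^ 0 - 1) * (p \in S)%:R).
  move=> Sab aQ bl.
  have pa : all prime a by move: pS; rewrite Sab all_cat => /andP[].
  have pb : all prime b by move: pS; rewrite Sab all_cat => /andP[].
  have aS : subseq a S by rewrite Sab prefix_subseq.
  have bS : subseq b S by rewrite Sab suffix_subseq.
  rewrite Sab size_cat exprD mulrC; apply: ler_pM; rewrite ?exprn_ge0 //.
    rewrite powR_expn; last lra.
    rewrite ler_powR ?(ltW a1) //.
    have := size_large_primes_le b (d * l) (C * l) bl (le_trans (nprod_subseq _ _ pS bS) SC).
    by rewrite mulrA ler_pM2r // ler_pdivlMr.
  rewrite -Sab; have := key Q 0 a (lexx _) aS aQ; rewrite powRr0 mulr1; apply.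
  apply/allP => p pa'; apply: le_trans aQ.
  have sp : subseq [:: p] a by rewrite sub1seq.
  by have := @nprod_subseq R [:: p] a pa sp; rewrite /nprod big_seq1.
have [SQ|[a [q [b [Sab aQ Qaq]]]]] := prefix_split S Q pS Q1.
  apply: le_trans (head S [::] _ SQ isT) _; first by rewrite cats0.
  by rewrite lerDl.
have pa : all prime a by move: pS; rewrite Sab all_cat => /andP[].
have pqb : all prime (q :: b) by move: pS; rewrite Sab all_cat => /andP[].
have pq : prime q by case/andP: pqb.
have q0 : 0 < q%:R :> R by rewrite ltr0n prime_gt0.
have pw : pairwise ltn S by rewrite -sorted_pairwise //; exact: ltn_trans.
rewrite Sab pairwise_cat /= in pw; case/and3P: pw => alt _ /andP[qb _].
have aq p : p \in a -> p%:R <= q%:R :> R.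
  move=> pa'; rewrite ler_nat ltnW //.
  by have := allrelP alt p q pa'; rewrite mem_head; apply.
have bq p : p \in q :: b -> q%:R <= p%:R :> R.
  by rewrite inE ler_nat => /orP[/eqP-> //|/(allP qb)/ltnW].
have [ql|ql] := ltP (expR (d * l)) q%:R.
  apply: le_trans (head a (q :: b) Sab aQ _) _; last by rewrite lerDl.
  by apply/allP => p /bq; apply: lt_le_trans.
have lq : ln q%:R <= d * l by rewrite -[leRHS]expRK ler_ln ?posrE ?expR_gt0.
have lq2 : ln 2 <= ln q%:R :> R.
  by rewrite ler_ln ?posrE // ler_nat prime_gt1.
have [j jJ /andP[j1 j2]] := dyadic_find J _ _ lq (lt_le_trans hJ lq2).
apply: (@le_trans _ _ ((2 ^+ j)^-1 *
      subsum (primes_upto (expR (d * l / 2 ^+ j))) Q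
        (fun p => (alpha * p%:R `^ (K * 2 ^+ j / (d * l)) - 1) * (p \in S)%:R))); last first.
  rewrite (bigD1 (Ordinal jJ)) //= addrCA lerDl addr_ge0 ?mulr_ge0 ?powR_ge0 ?sub0 //.
  apply: sumr_ge0 => i _; rewrite mulr_ge0 ?invr_ge0 ?exprn_ge0 //; exact: sub0.
have aS : subseq a S by rewrite Sab prefix_subseq.
have bS : subseq (q :: b) S by rewrite Sab suffix_subseq.
have qz : q%:R <= expR (d * l / 2 ^+ j) by rewrite -[leLHS](@lnK R) ?posrE ?ler_expR.
have qz' : expR (d * l / 2 ^+ j.+1) < q%:R by rewrite -[ltRHS](@lnK R) ?posrE ?ltr_expR.
set k := K * 2 ^+ j / (d * l).
have t0 : 0 < 2 ^+ j :> R by rewrite exprn_gt0.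
have := key (expR (d * l / 2 ^+ j)) k a (kj0 j) aS aQ.
move=> /(_ _)hk; have {}hk := hk (introT allP (fun p pa' => le_trans (aq p pa') qz)).
apply: le_trans (ler_wpM2l _ hk); last by rewrite invr_ge0 ltW.
(* The prefix was stopped by [q], so [nprod a > Q / q], and [q] is at most the square root of
   [Q]. *)
have na : expR (d * l) <= nprod a.
  have : expR (2 * d * l) < nprod a * expR (d * l).
    by apply: lt_le_trans Qaq _; rewrite ler_wpM2l // nprod_ge0.
  have -> : 2 * d * l = d * l + d * l by ring.
  by rewrite expRD ltr_pM2r ?expR_gt0 // => /ltW.
have nak : expR (K * 2 ^+ j) <= nprod a `^ k.
  have -> : K * 2 ^+ j = k * (d * l) by rewrite /k divfK // gt_eqF.
  have -> : expR (k * (d * l)) = expR (d * l) `^ k.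
    by rewrite /powR gt_eqF ?expR_gt0 // expRK.
  by rewrite ge0_ler_powR ?nnegrE ?expR_ge0 ?nprod_ge0 // kj0.
(* All primes from [q] on exceed [expR (d * l / 2^(j+1))], which limits their number. *)
have szb : (size (q :: b))%:R <= 2 * 2 ^+ j * C / d.
  have blt : all (fun p => expR (d * l / 2 ^+ j.+1) < p%:R) (q :: b).
    by apply/allP => p /bq; apply: lt_le_trans.
  have := size_large_primes_le _ _ (C * l) blt (le_trans (nprod_subseq _ _ pS bS) SC).
  rewrite exprS => h; rewrite ler_pdivlMr //.
  move: h; rewrite mulrA ler_pdivrMr ?mulr_gt0 //.
  have -> : (size (q :: b))%:R * (d * l) = (size (q :: b))%:R * d * l by rewrite mulrA.
  have -> : C * l * (2 * 2 ^+ j) = 2 * 2 ^+ j * C * l by ring.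
  by rewrite ler_pM2r.
rewrite Sab size_cat exprD mulrCA ler_wpM2l ?exprn_ge0 //.
rewrite powR_expn; last lra.
apply: (@le_trans _ _ (alpha `^ (2 * 2 ^+ j * C / d))).
  by rewrite ler_powR //; lra.
apply: le_trans (ler_wpM2l _ nak); last by rewrite invr_ge0 ltW.
rewrite /powR gt_eqF; last lra.
(* This explains the choice of [K]: the second summand pays for the factor [alpha] of each prime
   beyond [a], and the first gives [expR (2^j) >= 2^j], hence the summable factor [2^-j]. *)
have -> : K * 2 ^+ j = 2 ^+ j + 2 * 2 ^+ j * C / d * ln alpha.
  by rewrite /K; field; rewrite gt_eqF.
rewrite expRD mulrA ler_peMl ?expR_ge0 // mulrC ler_pdivlMr // mul1r.
by apply: le_trans (expR_ge1Dx _); rewrite lerDr.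
Qed.

End Pointwise.

(** * The upper bound on average *)

Lemma subsum_mean_le {R : realType} {A : Type} (X : seq A) (ind : nat -> A -> R)
    (eta h : nat -> R) (M K z Q : R) : 0 <= M -> 0 <= K ->
  (forall p, prime p -> 0 <= eta p <= 1) ->
  {in primes_upto z, forall p, 0 <= h p} ->
  (forall D, uniq D -> all prime D -> nprod D <= Q ->
     \sum_(x <- X) \prod_(p <- D) ind p x <= M * (\prod_(p <- D) eta p + K)) ->
  \sum_(x <- X) subsum (primes_upto z) Q (fun p => h p * ind p x) <=
  M * (\prod_(p <- primes_upto z) (1 + h p * eta p)
       + K * Q ^+ 2 * \prod_(p <- primes_upto z) (1 + h p / p%:R ^+ 2)).
Proof.
move=> M0 K0 eta01 h0 H; rewrite exchange_big /=.
have sub D : D \in subseqs (primes_upto z) -> uniq D /\ all prime D.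
  move=> /mem_subseqs sD; split; first exact: subseq_uniq sD (primes_upto_uniq _).
  by apply/allP => p /(mem_subseq sD); rewrite mem_primes_upto => /andP[].
apply: (@le_trans _ _ (\sum_(D <- subseqs (primes_upto z) | nprod D <= Q)
    (\prod_(p <- D) h p) * (M * (\prod_(p <- D) eta p + K)))).
  apply: ler_sum_seq => D sD DQ; have [uD pD] := sub D sD.
  apply: le_trans (ler_wpM2l _ (H D uD pD DQ)).
    by rewrite big_distrr /=; apply: ler_sum => x _; rewrite big_split.
  exact: subseqs_prod_ge0 sD.
(* The main terms are completed to a full Euler product; the error terms, without any [eta], are
   summed by Rankin's trick with exponent 2. *)
rewrite (eq_bigr (fun D => M * (\prod_(p <- D) (h p * eta p)) + M * K * \prod_(p <- D) h p));
  last by move=> D _; rewrite big_split /=; ring.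
rewrite big_split /= -!big_distrr /= mulrDr.
apply: lerD.
  rewrite ler_wpM2l //; apply: subsum_le_prod => p pz; rewrite mulr_ge0 ?h0 //.
  by move: pz; rewrite mem_primes_upto => /andP[/eta01/andP[]].
rewrite [leRHS]mulrA [M * (K * _)]mulrA -[leRHS]mulrA ler_wpM2l ?mulr_ge0 //.
exact: subsum_le_sqr h0 (all_prime_upto z).
Qed.

Section UpperBound.
Context {R : realType}.

Lemma le_subsum s (Q : R) (w w' : nat -> R) :
  {in s, forall p, 0 <= w p <= w' p} -> subsum s Q w <= subsum s Q w'.
Proof.
move=> ww; apply: ler_sum_seq => D /mem_subseqs/mem_subseq sD _.
by apply: ler_prod_seq => p /sD/ww.
Qed.

Lemma sum_inv_pow2_le2 J : \sum_(j < J) (2 ^+ j)^-1 <= 2 :> R.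
Proof.
suff : \sum_(j < J) (2 ^+ j)^-1 <= 2 - 2 * (2 ^+ J)^-1 :> R.
  move=> h; apply: le_trans h _; rewrite gerBl mulr_ge0 // invr_ge0 exprn_ge0 //.
elim: J => [|J IH]; first by rewrite big_ord0 expr0 invr1; lra.
rewrite big_ord_recr /= exprS invfM; lra.
Qed.

Lemma powR_le_expR (p : nat) (k t K : R) : prime p -> 0 <= k -> k * t <= K ->
  p%:R <= expR t -> p%:R `^ k <= expR K.
Proof.
move=> pp k0 ktK pt; have p0 : 0 < p%:R :> R by rewrite ltr0n prime_gt0.
rewrite /powR gt_eqF // ler_expR; apply: le_trans ktK; rewrite ler_wpM2l //.
by rewrite -[leRHS]expRK ler_ln ?posrE ?expR_gt0.
Qed.

Lemma powR_lnE (N e : R) : 2 <= N -> ln N `^ e = expR (e * ln (ln N)).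
Proof.
move=> N2; rewrite /powR gt_eqF //; apply: lt_le_trans ln2_gt0 _.
by rewrite ler_ln ?posrE //; lra.
Qed.

(** Write [alpha p^k - 1 = (alpha - 1) + alpha (p^k - 1)]. The first part produces the power of
    [ln N], and the second stays bounded because [k * t <= K1]. The constant [G] is uniform in [t]
    and [k], so one bound serves all dyadic scales. *)
Lemma model_upper_bound (alpha c M E K0 K1 : R) : 1 < alpha -> 0 < c -> 0 <= K0 ->
  0 <= K1 ->
  exists2 G : R, 0 < G & forall (eta : nat -> R) (N t k r : R),
    2 <= N -> (forall p, prime p -> 0 <= eta p <= 1) -> mertens c M E eta ->
    0 <= t <= ln N -> 0 <= k -> k * t <= K1 -> 0 <= r <= 1 ->
    \prod_(p <- primes_upto (expR t)) (1 + (alpha * p%:R `^ k - 1) * eta p)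
    + K0 * r * \prod_(p <- primes_upto (expR t))
        (1 + (alpha * p%:R `^ k - 1) / p%:R ^+ 2)
    <= G * ln N `^ ((alpha - 1) * c).
Proof.
move=> a1 c0 K00 K10; set e := (alpha - 1) * c.
have e0 : 0 <= e by rewrite mulr_ge0 //; lra.
set c1 := (alpha - 1) * (M + `|E| / ln 2)
  + alpha * (2 * dyadic_bound c E * K1 * expR K1).
(* The last factor is [(ln 2)^(-e)]: since [ln N >= ln 2], it lets a bounded error be absorbed into
   [(ln N)^e]. *)
set c2 := K0 * expR (2 * (alpha * expR K1)) * expR (- (e * ln (ln 2))).
have c20 : 0 <= c2 by rewrite !mulr_ge0 // expR_ge0.
exists (expR c1 + c2); first by rewrite ltr_pwDl // expR_gt0.
move=> eta N t k r N2 eta01 H /andP[t0 tN] k0 kt /andP[r0 r1].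
have pk1 (p : nat) : prime p -> 1 <= p%:R `^ k by move=> pp; apply: powR_prime_ge1.
rewrite mulrDl; apply: lerD.
  rewrite powR_lnE // -expRD.
  apply: (le_trans (prod1D_le_expR _ _ _ _)).
    move=> p; rewrite mem_primes_upto => /andP[pp _] _.
    have /andP[h0 _] := eta01 _ pp; rewrite addr_ge0 // mulr_ge0 //.
    by have := pk1 _ pp; nra.
  rewrite ler_expR.
  rewrite (eq_bigr (fun p => (alpha - 1) * eta p + alpha * (eta p * (p%:R `^ k - 1))));
    last by move=> p _; ring.
  rewrite big_split /= -!big_distrr /=.
  have tN' : expR t <= N by rewrite -[leRHS]lnK ?ler_expR // posrE; lra.
  have h1 := sum_eta_le _ _ _ _ _ _ H eta01 N2 tN'.
  have h2 := sum_eta_powR_sub1_le _ _ _ _ _ _ _ (ltW c0) H eta01 t0 k0 kt.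
  have a10 : 0 <= alpha - 1 by lra.
  have a0 : 0 <= alpha by lra.
  have := lerD (ler_wpM2l a10 h1) (ler_wpM2l a0 h2).
  by rewrite /c1 /e; lra.
apply: (@le_trans _ _ (K0 * expR (2 * (alpha * expR K1)))).
  apply: ler_pM; rewrite ?mulr_ge0 //.
  - apply: prodr_ge0_seq => p; rewrite mem_primes_upto => /andP[pp _] _.
    rewrite addr_ge0 // divr_ge0 ?sqr_ge0 //.
    by have := pk1 _ pp; nra.
  - by rewrite ler_piMr.
  apply: le_trans (prod1D_inv_sqr_le (expR t) _ _); last first.
    by rewrite mulr_ge0 ?expR_ge0 //; lra.
  apply: ler_prod_seq => p; rewrite mem_primes_upto => /andP[pp pt] _.
  have h1 := pk1 _ pp; have h2 := powR_le_expR _ _ _ _ pp k0 kt pt.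
  rewrite addr_ge0 ?divr_ge0 ?sqr_ge0 //=; last by nra.
  rewrite lerD2l ler_wpM2r ?invr_ge0 ?sqr_ge0 //; nra.
rewrite /c2 powR_lnE // -mulrA ler_peMr ?mulr_ge0 ?expR_ge0 //.
rewrite -expRD -[leLHS]expR0 ler_expR addrC -mulrBr mulr_ge0 // subr_ge0.
have lN : ln 2 <= ln N by rewrite ler_ln ?posrE //; lra.
by rewrite ler_ln ?posrE ?ln2_gt0 // (lt_le_trans ln2_gt0 lN).
Qed.

Lemma weight_sum_upper_bound (alpha xi c M E K0 C : R) :
  1 < alpha -> 0 < xi -> 0 < c -> 0 <= K0 -> 0 <= C ->
  exists2 B : R, 0 < B & forall (A : eqType) (X : seq A) (f : nat -> A -> int)
    (eta : nat -> R) (N z : R),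
  2 <= N -> (forall p, prime p -> 0 <= eta p <= 1) -> mertens c M E eta ->
  (forall D, uniq D -> all prime D -> nprod D <= expR (xi / 2 * ln N) ->
     `| \sum_(x <- X) \prod_(p <- D) sign_ind f 1 p x
        - (size X)%:R * \prod_(p <- D) eta p |
     <= (size X)%:R * (K0 * expR (- xi * ln N))) ->
  {in X, forall x, nprod [seq p <- primes_upto z | f p x == 1] <= expR (C * ln N)} ->
  \sum_(x <- X) \prod_(p <- primes_upto z) (1 + (alpha - 1) * sign_ind f 1 p x)
    <= B * (size X)%:R * ln N `^ ((alpha - 1) * c).
Proof.
move=> a1 xi0 c0 K00 C0.
(* [d <= 1/2] keeps [Q = N^(2d)] at most [N], and [d <= xi/8] gives [Q <= N^(xi/2)], the admissible
   moduli, and [Q^2 <= N^xi], the saving in the error term. *)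
set d : R := Num.min (1 / 2) (xi / 8).
have d0 : 0 < d by rewrite lt_min; apply/andP; split; lra.
have d1 : d <= 1 / 2 by rewrite ge_min lexx.
have d2 : d <= xi / 8 by rewrite ge_min lexx orbT.
have la0 : 0 <= ln alpha by apply: ln_ge0; lra.
set K := 2 * C * ln alpha / d + 1.
have Kge0 : 0 <= K by rewrite /K addr_ge0 // divr_ge0 ?mulr_ge0 // ltW.
have [G G0 HG] := model_upper_bound alpha c M E K0 K a1 c0 K00 Kge0.
(* The 2 is the bound for the sum of [2^-j] over the dyadic scales. *)
exists (G * (alpha `^ (C / d) + 2)).
  by rewrite mulr_gt0 // addr_gt0 // powR_gt0; lra.
move=> A X f eta N z N2 eta01 H Hc HX.
have l0 : 0 < ln N by apply: lt_le_trans ln2_gt0 _; rewrite ler_ln ?posrE //; lra.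
set l := ln N in l0 Hc HX *.
have dl0 : 0 < d * l by rewrite mulr_gt0.
set Q := expR (2 * d * l).
have [J hJ] := exists_pow2_gt (d * l / ln 2).
have {}hJ : d * l / 2 ^+ J < ln 2.
  by rewrite ltr_pdivrMr ?exprn_gt0 // [ltRHS]mulrC -ltr_pdivrMr ?ln2_gt0.
have mean t k : 0 <= t <= l -> 0 <= k -> k * t <= K ->
    \sum_(x <- X) subsum (primes_upto (expR t)) Q
      (fun p => (alpha * p%:R `^ k - 1) * sign_ind f 1 p x)
    <= (size X)%:R * (G * l `^ ((alpha - 1) * c)).
  move=> tl k0 kt.
  have r0 : 0 <= expR (- xi * l) * Q ^+ 2 <= 1.
    rewrite mulr_ge0 ?sqr_ge0 ?expR_ge0 //= /Q -expRM_natl -expRD -[leRHS]expR0 ler_expR.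
    nra.
  have Kr0 : 0 <= K0 * expR (- xi * l) by rewrite mulr_ge0 ?expR_ge0.
  apply: (le_trans (subsum_mean_le X (sign_ind f 1) eta _ (size X)%:R _ _ _ _ Kr0 eta01 _ _)).
  - by [].
  - move=> p; rewrite mem_primes_upto => /andP[pp _].
    by have := powR_prime_ge1 p k pp k0; nra.
  - move=> D uD pD DQ; rewrite mulrDr.
    have QY : Q <= expR (xi / 2 * l) by rewrite ler_expR; nra.
    by have := Hc D uD pD (le_trans DQ QY); rewrite ler_norml lerBlDl => /andP[].
  rewrite ler_wpM2l // -[K0 * _ * _]mulrA.
  exact: HG.
have lN j : d * l / 2 ^+ j <= l.
  rewrite ler_pdivrMr ?exprn_gt0 // mulrC ler_pM2l //.
  apply: le_trans (exprn_ege1 _ _) => //; lra.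
have m0 : 0 <= 2 * d * l <= l by apply/andP; split; nra.
have meanQ := mean _ 0 m0 (lexx _).
have meanj j := mean (d * l / 2 ^+ j) (K * 2 ^+ j / (d * l)).
apply: (@le_trans _ _ (\sum_(x <- X) (alpha `^ (C / d) *
      subsum (primes_upto Q) Q (fun p => (alpha * p%:R `^ 0 - 1) * sign_ind f 1 p x)
    + \sum_(j < J) (2 ^+ j)^-1 *
      subsum (primes_upto (expR (d * l / 2 ^+ j))) Q
        (fun p => (alpha * p%:R `^ (K * 2 ^+ j / (d * l)) - 1) * sign_ind f 1 p x)))).
  apply: ler_sum_seq => x xX _.
  set S := [seq p <- primes_upto z | f p x == 1].
  have -> : \prod_(p <- primes_upto z) (1 + (alpha - 1) * sign_ind f 1 p x) =
      alpha ^+ size S.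
    rewrite size_filter -iter_mulr_1 -big_const_seq [RHS]big_mkcond /=.
    by apply: eq_bigr => p _; rewrite /sign_ind; case: eqP => _ /=; ring.
  have sS : sorted ltn S.
    by apply: sorted_filter; [exact: ltn_trans|exact: primes_upto_sorted].
  have pS : all prime S.
    by apply/allP => p; rewrite mem_filter mem_primes_upto => /and3P[].
  apply: (le_trans (expn_size_le_subsums alpha d C l K Q S J a1 d0 C0 l0 sS pS (HX x xX)
    hJ erefl erefl)).
  (* The set [S] depends on [x]; replacing membership in it by the indicator, which is at least as
     large, makes the weights fit for averaging. *)
  have mono z' k : 0 <= k ->
      subsum (primes_upto z') Q (fun p => (alpha * p%:R `^ k - 1) * (p \in S)%:R) <=
      subsum (primes_upto z') Q (fun p => (alpha * p%:R `^ k - 1) * sign_ind f 1 p x).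
    move=> k0; apply: le_subsum => p; rewrite mem_primes_upto => /andP[pp _].
    have h0 : 0 <= alpha * p%:R `^ k - 1 by have := powR_prime_ge1 p k pp k0; nra.
    rewrite mulr_ge0 //= ler_wpM2l // /sign_ind mem_filter.
    by case: eqP => _ //=; rewrite lern1 leq_b1.
  apply: lerD; first by rewrite ler_wpM2l ?powR_ge0 // mono.
  apply: ler_sum => j _; rewrite ler_wpM2l ?invr_ge0 ?exprn_ge0 // mono //.
  by rewrite divr_ge0 ?mulr_ge0 ?exprn_ge0 // ltW.
rewrite big_split /= -big_distrr /= [X in _ + X <= _]exchange_big /=.
set T := (size X)%:R * (G * _) in mean meanQ meanj.
have T0 : 0 <= T by rewrite !mulr_ge0 ?powR_ge0 // ltW.
apply: (@le_trans _ _ (alpha `^ (C / d) * T + \sum_(j < J) (2 ^+ j)^-1 * T)).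
  apply: lerD; first by rewrite ler_wpM2l ?powR_ge0 //; apply: meanQ; rewrite mul0r.
  apply: ler_sum => j _; rewrite -big_distrr /= ler_wpM2l ?invr_ge0 ?exprn_ge0 // meanj //.
  - by rewrite lN divr_ge0 ?exprn_ge0 // ltW.
  - by rewrite divr_ge0 ?mulr_ge0 ?exprn_ge0 // ltW.
  - rewrite le_eqVlt; apply/orP; left; apply/eqP; field.
    by rewrite expf_neq0 ?pnatr_eq0 // !gt_eqF.
rewrite -big_distrl /= -mulrDl.
have := sum_inv_pow2_le2 J; rewrite /T.
set s := \sum_(j < J) _; set u := l `^ _ => h.
have -> : G * (alpha `^ (C / d) + 2) * (size X)%:R * u =
  (alpha `^ (C / d) + 2) * ((size X)%:R * (G * u)) by ring.
by rewrite ler_wpM2r // lerD2l.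
Qed.

End UpperBound.

(** * Lower bounds for Euler products and truncated expansions *)

Section LowerBound.
Context {R : realType}.

(** The tangent bound [ln l <= s l - ln s] with [s = b / (2 n)], [n > |e|], lets half of [b * l]
    absorb the term [e * ln l]; the other half grows without bound. *)
Lemma expR_linear_dominates (b K m e : R) : 0 < b -> 0 < m ->
  exists l0 : R, forall l, l0 <= l -> K <= m * expR (b * l + e * ln l).
Proof.
move=> b0 m0; set n := `|e| + 1.
have n0 : 0 < n by rewrite ltr_pwDr.
set s := b / (2 * n); have s0 : 0 < s by rewrite divr_gt0 // mulr_gt0.
exists (Num.max 1 (2 * (K / m - n * ln s) / b)) => l; rewrite ge_max => /andP[l1 lb].
have ll0 : 0 <= ln l by apply: ln_ge0.
have l0 : 0 < l by lra.
have h1 : ln l <= l * s - ln s.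
  have := le_ln1Dx (_ : -1 < l * s - 1); rewrite addrCA subrr addr0.
  rewrite lnM ?posrE // => /(_ _)h.
  have : ln l + ln s <= l * s - 1 by apply: h; nra.
  lra.
have h2 : - (n * (l * s - ln s)) <= e * ln l.
  have : - (n * ln l) <= e * ln l.
    by rewrite -mulNr ler_wpM2r // /n; have := ler_norm (- e); rewrite normrN; lra.
  by apply: le_trans; rewrite lerN2 ler_wpM2l // ltW.
have h3 : n * (l * s) = b * l / 2 by rewrite /s; field; rewrite gt_eqF.
have h4 : 2 * (K / m - n * ln s) <= b * l by move: lb; rewrite ler_pdivrMr // [l * b]mulrC.
have h5 : K / m <= b * l + e * ln l by move: h2; rewrite mulrBr h3; lra.
rewrite mulrC -ler_pdivrMr //; apply: (le_trans h5).
by apply: le_trans (expR_ge1Dx _); rewrite lerDr.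
Qed.

(** For [t = a * eta p >= 0] one has [ln (1 + t) >= t - t^2], and [t <= a K / p] makes the squares
    summable. *)
Lemma prod_plus_ge (a K : R) (eta : nat -> R) (z : R) : 0 <= a ->
  (forall p, prime p -> 0 <= eta p <= 1) ->
  (forall p, prime p -> eta p <= K / p%:R) ->
  expR (a * \sum_(p <- primes_upto z) eta p - 2 * (a * K) ^+ 2)
    <= \prod_(p <- primes_upto z) (1 + a * eta p).
Proof.
move=> a0 eta01 etaK.
apply: (@le_trans _ _ (expR (\sum_(p <- primes_upto z)
    (a * eta p - (a * K) ^+ 2 * (p%:R ^+ 2)^-1)))).
  rewrite ler_expR sumrB -!big_distrr /= lerD2l lerN2 mulrC.
  by rewrite ler_wpM2r ?sqr_ge0 // sum_inv_sqr_le2.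
rewrite expR_sum; apply: ler_prod_seq => p; rewrite mem_primes_upto => /andP[pp _] _.
rewrite expR_ge0 /=; have /andP[e0 e1] := eta01 _ pp; have eK := etaK _ pp.
set t := a * eta p; have t0 : 0 <= t by rewrite mulr_ge0.
apply: le_trans (expR_sub1V_le _ (1 + t) _); last lra.
rewrite ler_expR.
have -> : 1 - (1 + t)^-1 = t - t ^+ 2 / (1 + t) by field; rewrite gt_eqF //; lra.
rewrite lerD2l lerN2; apply: (@le_trans _ _ (t ^+ 2)).
  rewrite ler_pdivrMr; last lra.
  by rewrite ler_peMr ?sqr_ge0 //; lra.
have -> : (a * K) ^+ 2 * (p%:R ^+ 2)^-1 = (a * (K / p%:R)) ^+ 2.
  by rewrite mulrA expr_div_n.
by rewrite lerXn2r ?nnegrE ?ler_wpM2l //; apply: mulr_ge0 => //; apply: le_trans eK.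
Qed.

(** Here [ln (1 - t) >= - t - t^2 / (1 - t)] with [1 - t >= 1/alpha] and [t <= K / p], so the
    quadratic terms sum to at most [2 alpha K^2]. *)
Lemma prod_minus_ge (alpha K : R) (eta : nat -> R) (z : R) : 1 < alpha ->
  (forall p, prime p -> 0 <= eta p <= 1) ->
  (forall p, prime p -> eta p <= K / p%:R) ->
  expR (- ((1 - alpha^-1) * \sum_(p <- primes_upto z) eta p) - 2 * (alpha * K ^+ 2))
    <= \prod_(p <- primes_upto z) (1 - (1 - alpha^-1) * eta p).
Proof.
move=> a1 eta01 etaK; set th := 1 - alpha^-1.
have ai0 : 0 < alpha^-1 by rewrite invr_gt0; lra.
have ai1 : alpha^-1 < 1 by rewrite invf_lt1; lra.
have aK0 : 0 <= alpha * K ^+ 2 by rewrite mulr_ge0 ?sqr_ge0 //; lra.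
apply: (@le_trans _ _ (expR (\sum_(p <- primes_upto z)
    (- (th * eta p) - (alpha * K ^+ 2) * (p%:R ^+ 2)^-1)))).
  rewrite ler_expR sumrB sumrN -!big_distrr /= lerD2l lerN2 mulrC.
  by rewrite ler_wpM2r // sum_inv_sqr_le2.
rewrite expR_sum; apply: ler_prod_seq => p; rewrite mem_primes_upto => /andP[pp _] _.
rewrite expR_ge0 /=; have /andP[e0 e1] := eta01 _ pp; have eK := etaK _ pp.
have th0 : 0 <= th <= 1 by rewrite /th; lra.
case/andP: th0 => th0 th1.
set t := th * eta p; have t0 : 0 <= t by rewrite mulr_ge0.
have te : t <= eta p by rewrite ler_piMl.
have tth : t <= th by rewrite ler_piMr.
have u0 : alpha^-1 <= 1 - t by rewrite /th in tth; lra.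
have u1 : 0 < 1 - t by lra.
apply: le_trans (expR_sub1V_le _ (1 - t) u1).
rewrite ler_expR.
have -> : 1 - (1 - t)^-1 = - t - t ^+ 2 / (1 - t) by field; rewrite gt_eqF.
rewrite lerD2l lerN2.
have h1 : t ^+ 2 <= K ^+ 2 * (p%:R ^+ 2)^-1.
  rewrite -expr_div_n lerXn2r ?nnegrE //; last exact: le_trans eK.
  by rewrite (le_trans t0) // (le_trans te).
rewrite -mulrA [alpha * _]mulrC; apply: ler_pM; rewrite ?sqr_ge0 ?invr_ge0 ?(ltW u1) //.
by rewrite -[leRHS]invrK lef_pV2 ?posrE.
Qed.

(** Rankin's trick with [k = 1 / (eps l)], for which [p^k] stays below [expR 1] on the range. The
    tail is at most [expR (T - r / eps)] times the full product, and [eps <= d] makes this factor at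
    most [expR (-1) <= 1/2]. *)
Lemma subsum_half (a c M E r : R) : 0 <= a -> 0 < c -> 0 < r ->
  exists2 d : R, 0 < d & forall (eps : R) (eta : nat -> R) (l : R),
    0 < eps <= d -> 0 < l ->
    (forall p, prime p -> 0 <= eta p <= 1) -> mertens c M E eta ->
    1 / 2 * \prod_(p <- primes_upto (expR (eps * l))) (1 + a * eta p) <=
    subsum (primes_upto (expR (eps * l))) (expR (r * l)) (fun p => a * eta p).
Proof.
move=> a0 c0 r0; set T := a * (2 * dyadic_bound c E * 1 * expR 1).
have T0 : 0 <= T by rewrite !mulr_ge0 ?expR_ge0 // dyadic_bound_ge0 // ltW.
exists (r / (T + 1)); first by rewrite divr_gt0 // ltr_wpDl.
move=> eps eta l /andP[eps0 epsd] l0 eta01 H.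
have el0 : 0 < eps * l by rewrite mulr_gt0.
have w0 (z : R) : {in primes_upto z, forall p, 0 <= a * eta p}.
  move=> p; rewrite mem_primes_upto => /andP[pp _].
  by rewrite mulr_ge0 //; case/andP: (eta01 _ pp).
set k := (eps * l)^-1; have k0 : 0 <= k by rewrite invr_ge0 ltW.
have kl : k * (eps * l) <= 1 by rewrite mulVf // gt_eqF.
have := subsum_tail _ (expR (r * l)) _ k (w0 (expR (eps * l))) k0 (expR_gt0 _).
set P := \prod_(p <- _) (1 + a * eta p); set S := subsum _ _ _ => h.
suff : expR (r * l) `^ (- k) *
    \prod_(p <- primes_upto (expR (eps * l))) (1 + a * eta p * p%:R `^ k) <= 1 / 2 * P.
  lra.
have P0 : 0 <= P by apply: prodr_ge0_seq => p /w0 h0 _; rewrite addr_ge0.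
have hP : \prod_(p <- primes_upto (expR (eps * l))) (1 + a * eta p * p%:R `^ k)
    <= P * expR T.
  (* Factor by factor, [1 + x y <= (1 + x) (1 + x (y - 1))] for [x >= 0] and [y >= 1]. *)
  apply: (@le_trans _ _ (P * \prod_(p <- primes_upto (expR (eps * l)))
      (1 + a * (eta p * (p%:R `^ k - 1))))).
    rewrite /P -big_split /=; apply: ler_prod_seq => p pz _.
    have := w0 _ _ pz; move: pz; rewrite mem_primes_upto => /andP[pp _] h0.
    have := powR_prime_ge1 p k pp k0.
    move: h0; set x := a * eta p; set y := p%:R `^ k => h0 y1.
    have -> : a * (eta p * (y - 1)) = x * (y - 1) by rewrite mulrA.
    apply/andP; split; first by nra.
    have y0 : 0 <= y - 1 by rewrite subr_ge0.
    have := mulr_ge0 h0 (mulr_ge0 h0 y0); nra.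
  rewrite ler_wpM2l //; apply: (le_trans (prod1D_le_expR _ _ _ _)).
    move=> p; rewrite mem_primes_upto => /andP[pp _] _.
    have /andP[e0 _] := eta01 _ pp; rewrite addr_ge0 // !mulr_ge0 // subr_ge0.
    exact: powR_prime_ge1.
  rewrite ler_expR -big_distrr /= ler_wpM2l //.
  exact: sum_eta_powR_sub1_le (ltW c0) H eta01 (ltW el0) k0 kl.
apply: (le_trans (ler_wpM2l (powR_ge0 _ _) hP)).
rewrite mulrCA [leRHS]mulrC ler_wpM2l //.
rewrite /powR gt_eqF ?expR_gt0 // expRK -expRD.
have -> : - k * (r * l) = - (r / eps) by rewrite /k; field; rewrite !gt_eqF.
have : T + 1 <= r / eps.
  by rewrite ler_pdivlMr // mulrC -ler_pdivlMr // ltr_wpDl.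
move=> hT; apply: (@le_trans _ _ (expR (- 1))); first by rewrite ler_expR; lra.
rewrite expRN div1r lef_pV2 ?posrE ?expR_gt0 //.
by apply: le_trans (expR_ge1Dx _); lra.
Qed.

End LowerBound.

(** * The lower bound on average for large [N] *)

Section LowerBoundSum.
Context {R : realType}.

(** This equals [alpha^(f p x)] whenever [f p x] is -1, 0 or 1. *)
Definition signed_weight {A : eqType} (alpha : R) (f : nat -> A -> int) p x : R :=
  (1 + (alpha - 1) * sign_ind f 1 p x) * (1 - (1 - alpha^-1) * sign_ind f (-1) p x).

(** Only primes with [f p x = -1] give factors below 1, namely [1/alpha], and at most [u / t] of
    them fit under the size bound. *)
Lemma signed_weight_prod_ge {A : eqType} (alpha t u : R) (f : nat -> A -> int) x s :
  1 < alpha -> 0 < t -> all (fun p => expR t < p%:R) s ->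
  nprod [seq p <- s | f p x == -1] <= expR u ->
  alpha `^ (- (u / t)) <= \prod_(p <- s) signed_weight alpha f p x.
Proof.
move=> a1 t0 st su.
have ai0 : 0 < alpha^-1 by rewrite invr_gt0; lra.
apply: (@le_trans _ _ (\prod_(p <- s | f p x == -1) alpha^-1)); last first.
  rewrite big_mkcond /=; apply: ler_prod => p _; rewrite /signed_weight /sign_ind.
  case: (f p x =P -1) => [->|_]; rewrite /=; first by nra.
  by case: eqP => _ /=; rewrite ?mulr0 ?mulr1 ?subr0; lra.
rewrite big_const_seq iter_mulr_1 exprVn powRN.
rewrite lef_pV2 ?posrE ?exprn_gt0 ?powR_gt0 //; [|lra|lra].
rewrite powR_expn; last lra.
rewrite ler_powR ?(ltW a1) // ler_pdivlMr // -size_filter.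
apply: size_large_primes_le su; apply/allP => p; rewrite mem_filter => /andP[_].
exact: (allP st).
Qed.

Lemma weight_sum_lower_bound (alpha xi cp cm Mp Mm Ep Em K0 Kp Km C : R) :
  1 < alpha -> 0 < xi -> 0 < cp -> 0 < cm -> 0 <= K0 -> 1 <= C ->
  exists B l0 : R, 0 < B /\
  forall (A : eqType) (X : seq A) (f : nat -> A -> int)
    (etap etam : nat -> R) (N : R),
  2 <= N -> l0 <= ln N ->
  (forall p, prime p -> 0 <= etap p <= 1) ->
  (forall p, prime p -> 0 <= etam p <= 1) ->
  mertens cp Mp Ep etap -> mertens cm Mm Em etam ->
  (forall p, prime p -> etap p <= Kp / p%:R) ->
  (forall p, prime p -> etam p <= Km / p%:R) ->
  (forall Dm Dp, uniq (Dm ++ Dp) -> all prime Dm -> all prime Dp ->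
    nprod Dm * nprod Dp <= expR (xi / 2 * ln N) ->
    `| \sum_(x <- X) \prod_(p <- Dp) sign_ind f 1 p x *
         \prod_(p <- Dm) sign_ind f (-1) p x
       - (size X)%:R * \prod_(p <- Dp) etap p * \prod_(p <- Dm) etam p |
    <= (size X)%:R * (K0 * expR (- xi * ln N))) ->
  {in X, forall x, nprod [seq p <- primes_upto (expR (C * ln N)) | f p x == -1]
                     <= expR (C * ln N)} ->
  B * (size X)%:R * ln N `^ ((alpha - 1) * cp - (1 - alpha^-1) * cm)
    <= \sum_(x <- X) \prod_(p <- primes_upto (expR (C * ln N))) signed_weight alpha f p x.
Proof.
move=> a1 xi0 cp0 cm0 K00 C1.
set a := alpha - 1; set th := 1 - alpha^-1; set e := a * cp - th * cm.
have a0 : 0 <= a by rewrite /a; lra.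
have ai0 : 0 < alpha^-1 by rewrite invr_gt0; lra.
have ai1 : alpha^-1 < 1 by rewrite invf_lt1; lra.
have th01 : 0 <= th <= 1 by rewrite /th; lra.
have [th0 th1] := andP th01.
have r0 : 0 < xi / 8 by lra.
have [d d0 Hd] := subsum_half a cp Mp Ep (xi / 8) a0 cp0 r0.
have [k Hk] := sieve_lower_bound alpha _ a1 (dyadic_bound_ge0 cm Em (ltW cm0)).
have k60 : 0 < (2 * k + 6)%:R :> R by rewrite ltr0n addn_gt0 orbT.
(* The level [k] is already fixed. [eps <= d] keeps half of the truncated expansion,
   [eps (2 k + 6) <= xi/8] bounds the sieve moduli by [N^(xi/8)], and [eps <= 1 <= C] puts the range
   inside [N^C]. *)
set eps : R := Num.min 1 (Num.min d (xi / 8 / (2 * k + 6)%:R)).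
have eps0 : 0 < eps by rewrite !lt_min ltr01 d0 divr_gt0.
have eps1 : eps <= 1 by rewrite ge_min lexx.
have epsd : eps <= d by rewrite !ge_min lexx orbT.
have epsk : eps * (2 * k + 6)%:R <= xi / 8.
  by rewrite -ler_pdivlMr // !ge_min lexx !orbT.
(* The constants in the lower bound for the logarithm of [Pp * Pm], after writing
   [ln (eps * l) = ln eps + ln l]. *)
set m0 := a * (cp * ln eps + (Mp - `|Ep| / ln 2)) - 2 * (a * Kp) ^+ 2
  - th * (cm * ln eps + (Mm + `|Em| / ln 2)) - 2 * (alpha * Km ^+ 2).
set K1 := K0 * expR 2 * expR (2 * a).
have [l1 Hl1] := expR_linear_dominates (xi / 2) K1 (expR m0 / 8) e
  ltac:(lra) ltac:(by rewrite divr_gt0 ?expR_gt0).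
(* The power of [alpha] pays for the primes beyond [N^eps]. The sieve and the truncation each keep
   one half, leaving [1/4], and for [ln N >= l1] the error takes at most [1/8]. The condition
   [ln N >= ln 2 / eps] ensures [N^eps >= 2]. *)
exists (alpha `^ (- (C / eps)) * (expR m0 / 8)), (Num.max l1 (ln 2 / eps)); split.
  by rewrite mulr_gt0 ?divr_gt0 ?powR_gt0 ?expR_gt0 //; lra.
move=> A X f etap etam N N2; rewrite ge_max => /andP[lN1 lN2] ep01 em01 Hp Hm epK emK Hc HX.
have l0 : 0 < ln N by apply: lt_le_trans ln2_gt0 _; rewrite ler_ln ?posrE //; lra.
rewrite powR_lnE //; set l := ln N in l0 lN1 lN2 Hc HX *.
have el0 : 0 < eps * l by rewrite mulr_gt0.
have xl0 : 0 < xi * l by rewrite mulr_gt0.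
set z := expR (eps * l).
have z2 : 2 <= z.
  by rewrite -[leLHS]lnK ?posrE // ler_expR mulrC -ler_pdivrMr.
have zz : z <= expR (C * l) by rewrite ler_expR ler_pM2r //; lra.
set Y := expR (eps * l * (2 * k + 6)%:R).
have Yx : Y <= expR (xi / 8 * l) by rewrite ler_expR mulrAC ler_wpM2r // ltW.
set Q := expR (xi / 8 * l).
set Pm := \prod_(p <- primes_upto z) (1 - th * etam p).
set Pp := \prod_(p <- primes_upto z) (1 + a * etap p).
have Xm01 p x : 0 <= 1 - th * sign_ind f (-1) p x <= 1.
  by have /andP[i0 i1] := @sign_ind01 R A f (-1) p x; apply/andP; split; nra.
have pt x : x \in X -> alpha `^ (- (C / eps)) *
    (subsum (primes_upto z) Q (fun p => a * sign_ind f 1 p x) *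
     \prod_(p <- primes_upto z) (1 - th * sign_ind f (-1) p x))
    <= \prod_(p <- primes_upto (expR (C * l))) signed_weight alpha f p x.
  move=> xX; rewrite [leRHS](prod_filterC _ (fun p => p%:R <= z)) /= [leLHS]mulrC.
  rewrite -[T in _ <= T * _]big_filter (perm_big _ (primes_upto_filter _ _ zz)) /=.
  apply: ler_pM; rewrite ?powR_ge0 //.
  - apply: mulr_ge0; last by apply: prodr_ge0 => p _; have /andP[] := Xm01 p x.
    apply: sumr_ge0_seq => D sD _; apply: subseqs_prod_ge0 sD => p _.
    by rewrite mulr_ge0 //; have /andP[] := @sign_ind01 R A f 1 p x.
  - rewrite /signed_weight big_split /=; apply: ler_pM => //.
    + apply: sumr_ge0_seq => D sD _; apply: subseqs_prod_ge0 sD => p _.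
      by rewrite mulr_ge0 //; have /andP[] := @sign_ind01 R A f 1 p x.
    + by apply: prodr_ge0 => p _; have /andP[] := Xm01 p x.
    + apply: subsum_le_prod => p _.
      by rewrite mulr_ge0 //; have /andP[] := @sign_ind01 R A f 1 p x.
  - rewrite -big_filter.
    have -> : C / eps = C * l / (eps * l) by field; rewrite !gt_eqF.
    apply: signed_weight_prod_ge => //.
      by apply/allP => p; rewrite mem_filter -ltNge => /andP[].
    apply: le_trans (HX x xX); apply: nprod_subseq.
      by apply/allP => p; rewrite mem_filter mem_primes_upto => /and3P[].
    rewrite subseq_filter filter_all /=.
    exact: subseq_trans (filter_subseq _ _) (filter_subseq _ _).
apply: le_trans (ler_sum_seq _ _ _ _ (fun x xX _ => pt x xX)).
rewrite -big_distrr /= -!mulrA ler_wpM2l ?powR_ge0 //.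
set E := K0 * expR (- xi * l).
have E0 : 0 <= E by rewrite mulr_ge0 ?expR_ge0.
(* For a fixed divisor [D], the sieve is applied with the indicator that [f p x = 1] on all of [D]
   as weight. *)
have inner D : D \in subseqs (primes_upto z) -> nprod D <= Q ->
    (size X)%:R * (\prod_(p <- D) etap p * Pm / 2 - E * expR 2 * Y ^+ 2) <=
    \sum_(x <- X) \prod_(p <- D) sign_ind f 1 p x *
      \prod_(p <- primes_upto z) (1 - th * sign_ind f (-1) p x).
  move=> /mem_subseqs sD DQ.
  have uD : uniq D by apply: subseq_uniq sD (primes_upto_uniq _).
  have pD : all prime D.
    by apply/allP => p /(mem_subseq sD); rewrite mem_primes_upto => /andP[].
  have De0 : 0 <= \prod_(p <- D) etap p.
    by apply: prodr_ge0_seq => p /(allP pD)/ep01/andP[].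
  have M0 : 0 <= (size X)%:R * \prod_(p <- D) etap p by rewrite mulr_ge0.
  have sE0 : 0 <= (size X)%:R * E by rewrite mulr_ge0.
  have := Hk A X (fun x => \prod_(p <- D) sign_ind f 1 p x) (sign_ind f (-1)) etam
    ((size X)%:R * \prod_(p <- D) etap p) ((size X)%:R * E) (eps * l) D M0 sE0 (ltW el0)
    em01 (fun l' l'0 => sum_dyadic_le _ _ _ _ _ (ltW cm0) Hm em01 l'0).
  move=> /(_ _ _ _) h; have {}h := h _ (@sign_ind01 R A f (-1)) _.
  have g0 x : 0 <= \prod_(p <- D) sign_ind f 1 p x.
    by apply: prodr_ge0 => p _; have /andP[] := @sign_ind01 R A f 1 p x.
  have {}h := h (g0 R).
  apply: (@le_trans _ _ (\sum_(x <- X) \prod_(p <- D) sign_ind f 1 p x *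
      \prod_(p <- primes_upto z | p \notin D) (1 - th * sign_ind f (-1) p x))); last first.
    (* Where the weight is non-zero, [f p x = 1] for the primes of [D], so their second factors
       equal 1. *)
    apply: ler_sum => x _; rewrite prod_sign_ind.
    case: allP => hx; rewrite ?mul0r // !mul1r.
    rewrite [leRHS](prod_filterC _ (fun p => p \notin D)) /=.
    rewrite [T in _ <= _ * T]big1 ?mulr1 // => p; rewrite negbK => /hx/eqP fp.
    by rewrite /sign_ind fp mulr0 subr0.
  apply: le_trans (h _); last first.
    move=> D' uD' pD' DD' D'Y; apply: Hc => //.
    - rewrite cat_uniq uD' uD andbT /= -all_predC.
      by apply/allP => p pD2; apply/negP => /(allP DD'); rewrite pD2.
    - apply: le_trans (ler_pM (nprod_ge0 _) (nprod_ge0 _) (le_trans D'Y Yx) DQ) _.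
      by rewrite -expRD ler_expR; lra.
  rewrite -/Y -/th -/z mulrBr -!mulrA; apply: lerB; last by rewrite !mulrA.
  rewrite ler_wpM2l // ler_wpM2l // mulrC ler_wpM2l //.
  rewrite /Pm (prod_filterC _ (fun p => p \notin D)) /= ler_piMr //.
    apply: prodr_ge0_seq => p; rewrite mem_primes_upto => /andP[pp _] _.
    by have /andP[] := em01 _ pp; nra.
  apply: prodr_le1_seq => p; rewrite mem_primes_upto => /andP[pp _] _.
  by have /andP[h0 h1] := em01 _ pp; apply/andP; split; nra.
apply: (@le_trans _ _ (\sum_(D <- subseqs (primes_upto z) | nprod D <= Q)
    a ^+ size D * ((size X)%:R *
      (\prod_(p <- D) etap p * Pm / 2 - E * expR 2 * Y ^+ 2)))); last first.
  rewrite (eq_bigr (fun x => \sum_(D <- subseqs (primes_upto z) | nprod D <= Q)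
      a ^+ size D * (\prod_(p <- D) sign_ind f 1 p x *
      \prod_(p <- primes_upto z) (1 - th * sign_ind f (-1) p x)))); last first.
    move=> x _; rewrite big_distrl /=; apply: eq_bigr => D _.
    by rewrite big_split /= big_const_seq count_predT iter_mulr_1 mulrA.
  rewrite exchange_big /=; apply: ler_sum_seq => D sD DQ.
  by rewrite -big_distrr /= ler_wpM2l ?exprn_ge0 // inner.
rewrite (eq_bigr (fun D => (size X)%:R * (Pm / 2) * \prod_(p <- D) (a * etap p)
    - (size X)%:R * (E * expR 2 * Y ^+ 2) * \prod_(p <- D) a)); last first.
  move=> D _; rewrite big_split /= !big_const_seq !count_predT !iter_mulr_1.
  by field.
rewrite sumrB -!big_distrr /= -/(subsum (primes_upto z) Q (fun p => a * etap p))
  -/(subsum (primes_upto z) Q (fun=> a)).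
have h1 : 1 / 2 * Pp <= subsum (primes_upto z) Q (fun p => a * etap p).
  by apply: Hd => //; rewrite eps0.
have h2 : subsum (primes_upto z) Q (fun=> a) <= Q ^+ 2 * expR (2 * a).
  apply: le_trans (subsum_le_sqr _ _ _ (fun p _ => a0) (all_prime_upto z)) _.
  by rewrite ler_wpM2l ?sqr_ge0 // prod1D_inv_sqr_le.
have h3 : expR (m0 + e * ln l) <= Pp * Pm.
  have sp := sum_eta_ge _ _ _ _ _ Hp z2.
  have sm := sum_eta_le _ _ _ _ _ _ Hm em01 z2 (lexx z).
  apply: le_trans (ler_pM (expR_ge0 _) (expR_ge0 _)
    (prod_plus_ge a Kp etap z a0 ep01 epK) (prod_minus_ge alpha Km etam z a1 em01 emK)).
  rewrite -expRD ler_expR -/th.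
  have := ler_wpM2l a0 sp; have := ler_wpM2l th0 sm.
  rewrite /z expRK lnM ?posrE // -/z.
  rewrite /m0 /e; lra.
have h4 := Hl1 l lN1.
have Pm0 : 0 <= Pm.
  apply: prodr_ge0_seq => p; rewrite mem_primes_upto => /andP[pp _] _.
  by have /andP[] := em01 _ pp; nra.
(* The saving [N^(-xi)] meets the losses [Y^2] and [Q^2], each at most [N^(xi/4)], so [N^(-xi/2)]
   remains. *)
have h5 : E * expR 2 * Y ^+ 2 * (Q ^+ 2 * expR (2 * a)) <= K1 * expR (- (xi / 2 * l)).
  have -> : E * expR 2 * Y ^+ 2 * (Q ^+ 2 * expR (2 * a)) =
    K1 * (expR (- xi * l) * Y ^+ 2 * Q ^+ 2) by rewrite /E /K1; ring.
  rewrite ler_wpM2l ?mulr_ge0 ?expR_ge0 //.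
  apply: (@le_trans _ _ (expR (- xi * l) * Q ^+ 2 * Q ^+ 2)).
    rewrite ler_wpM2r ?sqr_ge0 // ler_wpM2l ?expR_ge0 // lerXn2r ?nnegrE ?expR_ge0 //.
  by rewrite /Q -!expRM_natl -!expRD ler_expR; lra.
have h6 : K1 * expR (- (xi / 2 * l)) <= expR m0 / 8 * expR (e * ln l).
  have -> : expR m0 / 8 * expR (e * ln l) =
      expR m0 / 8 * expR (xi / 2 * l + e * ln l) * expR (- (xi / 2 * l)).
    by rewrite -[RHS]mulrA -expRD; congr (_ * expR _); ring.
  by rewrite ler_wpM2r ?expR_ge0.
have h7 : E * expR 2 * Y ^+ 2 * subsum (primes_upto z) Q (fun=> a) <=
    expR m0 / 8 * expR (e * ln l).
  apply: le_trans h6; apply: le_trans h5; rewrite ler_wpM2l //.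
  by rewrite !mulr_ge0 ?sqr_ge0 ?expR_ge0.
have h8 : Pm / 2 * (1 / 2 * Pp) <= Pm / 2 * subsum (primes_upto z) Q (fun p => a * etap p).
  by rewrite ler_wpM2l // divr_ge0.
have h9 : expR m0 / 8 * expR (e * ln l) <=
    Pm / 2 * subsum (primes_upto z) Q (fun p => a * etap p) -
    E * expR 2 * Y ^+ 2 * subsum (primes_upto z) Q (fun=> a).
  by move: h3; rewrite expRD; lra.
by have := ler_wpM2l (ler0n R (size X)) h9; lra.
Qed.

End LowerBoundSum.

(** * Assembly: uniform constants, and small [N] *)

Lemma powR_gt0E {R : realType} (N a : R) : 0 < N -> N `^ a = expR (a * ln N).
Proof. by move=> N0; rewrite /powR gt_eqF. Qed.

Lemma sign_nprod_le {R : realType} {A : eqType} (f : nat -> A -> int) x (z : R) (e : int) :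
  e != 0 -> (forall n, partial_supp_prod f x n <= z) ->
  nprod [seq p <- primes_upto z | f p x == e] <= z.
Proof.
move=> e0 h; apply: le_trans (supp_prod_le _ _ _ h); rewrite -big_filter.
apply: nprod_subseq.
  by apply/allP => p; rewrite mem_filter mem_primes_upto => /and3P[].
rewrite subseq_filter filter_subseq andbT; apply/allP => p.
by rewrite mem_filter => /andP[/eqP ->].
Qed.

Theorem theorem5p2 (R : realType)
  (alpha xi cp cm Mp Mm C : R)
  (K0 a1 a2 Kp Km Ep Em KC : R) :
  1 < alpha -> 0 < xi -> 0 < cp -> 0 < cm -> 0 < C -> 0 < a1 ->
  exists B1 B2 : R, 0 < B1 /\ 0 < B2 /\
  forall (A : eqType) (ht : A -> R) (AN : R -> seq A)
         (f : nat -> A -> int) (etap etam : nat -> R),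
    ~ finite_set [set: A] ->
    (forall N, uniq (AN N)) ->
    (forall N x, (x \in AN N) = (ht x <= N)) ->
    (forall N, 2 <= N ->
       a1 * ln N <= ln (size (AN N))%:R <= a2 * ln N) ->
    (forall p x, prime p -> f p x \in [:: -1; 0; 1]%R) ->
    mult01 etap -> mult01 etam ->
    (forall N, 2 <= N -> forall qm qp : nat,
       squarefree qm -> squarefree qp -> coprime qm qp ->
       ((qm * qp)%N%:R <= N `^ (xi / 2)) ->
       `| (count_sign (AN N) f qm qp)%:R / (size (AN N))%:R
          - etam qm * etap qp | <= K0 * N `^ (- xi)) ->
    (forall p, prime p -> etap p <= Kp / p%:R) ->
    (forall p, prime p -> etam p <= Km / p%:R) ->
    (forall N, 2 <= N ->
       `| sum_primes_le N etap - (cp * ln (ln N) + Mp) | <= Ep / ln N) ->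
    (forall N, 2 <= N ->
       `| sum_primes_le N etam - (cm * ln (ln N) + Mm) | <= Em / ln N) ->
    (forall N, 2 <= N -> forall x, x \in AN N -> forall n,
       partial_supp_prod f x n <= KC * N `^ C) ->
    forall N, 2 <= N ->
      B1 * (size (AN N))%:R
         * (ln N) `^ ((alpha - 1) * cp - (1 - alpha^-1) * cm)
        <= \sum_(x <- AN N) euler_weight alpha f x
      /\ \sum_(x <- AN N) euler_weight alpha f x
        <= B2 * (size (AN N))%:R * (ln N) `^ ((alpha - 1) * cp).
Proof.
move=> al1 xi0 cp0 cm0 C0 a10.
have ln20 : 0 < ln 2 :> R := ln2_gt0.
set KC' := `|KC| + 1.
have KC1 : 1 <= KC' by rewrite /KC' lerDr.
have lKC0 : 0 <= ln KC' by apply: ln_ge0.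
(* For [N >= 2] the constant [KC'] is at most [N^(ln KC' / ln 2)], so the support bound becomes a
   pure power [N^C2]; the added 1 gives [C2 >= 1]. *)
set C2 := C + ln KC' / ln 2 + 1.
have lK0 : 0 <= ln KC' / ln 2 by rewrite divr_ge0 // ltW.
have C21 : 1 <= C2 by rewrite /C2; lra.
have C20 : 0 <= C2 by lra.
have [B2 B20 HB2] := weight_sum_upper_bound alpha xi cp Mp Ep `|K0| C2
  al1 xi0 cp0 (normr_ge0 _) C20.
have [B [l0 [B0 HB]]] := weight_sum_lower_bound alpha xi cp cm Mp Mm Ep Em `|K0| Kp Km C2
  al1 xi0 cp0 cm0 (normr_ge0 _) C21.
set e := (alpha - 1) * cp - (1 - alpha^-1) * cm.
set T := `|e| * (`|ln (ln 2)| + `|ln l0|).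
(* The constant for [ln N < l0]: the first factor bounds each weight from below, and [expR (- T)]
   compensates [(ln N)^e], since [ln ln N] lies between [ln ln 2] and [ln l0]. *)
set Bs := alpha `^ (- (C2 * l0 / (ln 2 / 2))) * expR (- T).
have Bs0 : 0 < Bs by rewrite mulr_gt0 ?expR_gt0 // powR_gt0; lra.
exists (Num.min B Bs), B2; split; first by rewrite lt_min B0.
split=> // A ht AN f etap etam _ _ _ Hsize Hf mp mm Hc HKp HKm HMp HMm Hsupp N N2.
have N0 : 0 < N by lra.
have l2 : ln 2 <= ln N by rewrite ler_ln ?posrE.
have lN0 : 0 < ln N by lra.
(* An empty set would have [ln 0 = 0] by convention, against the positive lower bound
   [a1 * ln N]. *)
have sA : (0 < size (AN N))%N.
  rewrite lt0n; apply/eqP => s0; have := Hsize N N2; rewrite s0 [ln 0%:R]ln0 // => /andP[h _].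
  by have := mulr_gt0 a10 lN0; lra.
set z := expR (C2 * ln N).
have zle : KC * N `^ C <= z.
  rewrite powR_gt0E //; apply: (@le_trans _ _ (KC' * expR (C * ln N))).
    by rewrite ler_wpM2r ?expR_ge0 // /KC'; have := ler_norm KC; lra.
  rewrite -{1}[KC']lnK ?posrE; last lra.
  rewrite -expRD ler_expR /C2 !mulrDl mul1r.
  have : ln KC' <= ln KC' / ln 2 * ln N.
    by rewrite mulrAC ler_pdivlMr // ler_wpM2l.
  lra.
have supp x : x \in AN N -> forall n, partial_supp_prod f x n <= z.
  by move=> xN n; apply: le_trans zle; apply: Hsupp.
have eta01 (eta : nat -> R) : mult01 eta -> forall p, prime p -> 0 <= eta p <= 1.
  by move=> [_ [_ h]] p pp; apply: h; apply: prime_gt0.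
have Mp' : mertens cp Mp Ep etap.
  by move=> n n2; rewrite -sum_primes_leE; apply: HMp.
have Mm' : mertens cm Mm Em etam.
  by move=> n n2; rewrite -sum_primes_leE; apply: HMm.
have Hc' Dm Dp : uniq (Dm ++ Dp) -> all prime Dm -> all prime Dp ->
    nprod Dm * nprod Dp <= expR (xi / 2 * ln N) ->
    `| \sum_(x <- AN N) \prod_(p <- Dp) sign_ind f 1 p x *
         \prod_(p <- Dm) sign_ind f (-1) p x
       - (size (AN N))%:R * \prod_(p <- Dp) etap p * \prod_(p <- Dm) etam p |
    <= (size (AN N))%:R * (`|K0| * expR (- xi * ln N)).
  apply: count_estimate => // qm qp sm sp co qY.
  apply: le_trans (Hc N N2 qm qp sm sp co _) _; first by rewrite powR_gt0E.
  by rewrite powR_gt0E // ler_wpM2r ?expR_ge0 // ler_norm.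
have eW x : x \in AN N ->
    euler_weight alpha f x = \prod_(p <- primes_upto z) signed_weight alpha f p x.
  move=> xN; rewrite (euler_weightE alpha f x z (supp x xN)).
  rewrite big_seq [RHS]big_seq; apply: eq_bigr => p.
  rewrite mem_primes_upto => /andP[pp _]; apply: exprz_sign_ind => //; exact: Hf.
have -> : \sum_(x <- AN N) euler_weight alpha f x =
    \sum_(x <- AN N) \prod_(p <- primes_upto z) signed_weight alpha f p x.
  by rewrite big_seq [RHS]big_seq; apply: eq_bigr => x; apply: eW.
have ai0 : 0 < alpha^-1 by rewrite invr_gt0; lra.
have ai1 : alpha^-1 < 1 by rewrite invf_lt1; lra.
have Xp01 p x := @sign_ind01 R A f 1 p x; have Xm01 p x := @sign_ind01 R A f (-1) p x.
split; last first.
  apply: (@le_trans _ _ (\sum_(x <- AN N) \prod_(p <- primes_upto z)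
      (1 + (alpha - 1) * sign_ind f 1 p x))).
    apply: ler_sum => x _; apply: ler_prod => p _; rewrite /signed_weight.
    have /andP[p0 _] := Xp01 p x; have /andP[m0 m1] := Xm01 p x.
    have u0 : 0 <= 1 + (alpha - 1) * sign_ind f 1 p x by nra.
    have v0 : 0 <= 1 - (1 - alpha^-1) * sign_ind f (-1) p x <= 1.
      by apply/andP; split; nra.
    by case/andP: v0 => v0 v1; rewrite mulr_ge0 //= ler_piMr.
  apply: (HB2 A (AN N) f etap N z N2 (eta01 _ mp) Mp').
    (* The counting estimate is taken here with [q_- = 1], the empty list of primes. *)
    move=> D uD pD DY; have := Hc' [::] D uD isT pD.
    rewrite {1}/nprod !big_nil mul1r mulr1 => /(_ DY).
    rewrite (eq_bigr (fun x => \prod_(p <- D) sign_ind f 1 p x)) //.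
    by move=> x _; rewrite big_nil mulr1.
  by move=> x xN; apply: sign_nprod_le => //; apply: supp.
have [ll|ll] := leP l0 (ln N).
  apply: le_trans (HB A (AN N) f etap etam N N2 ll (eta01 _ mp) (eta01 _ mm) Mp' Mm'
    HKp HKm Hc' _).
    by rewrite ler_wpM2r ?powR_ge0 // ler_wpM2r // ge_min lexx.
  by move=> x xN; apply: sign_nprod_le => //; apply: supp.
apply: (@le_trans _ _ (Bs * (size (AN N))%:R * ln N `^ e)).
  by rewrite ler_wpM2r ?powR_ge0 // ler_wpM2r // ge_min lexx orbT.
have ptw x : x \in AN N -> alpha `^ (- (C2 * l0 / (ln 2 / 2))) <=
    \prod_(p <- primes_upto z) signed_weight alpha f p x.
  move=> xN; apply: (@le_trans _ _ (alpha `^ (- (C2 * ln N / (ln 2 / 2))))).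
    rewrite ler_powR ?(ltW al1) // lerN2 ler_wpM2r ?invr_ge0 ?divr_ge0 ?(ltW ln20) //.
    by rewrite ler_wpM2l // ltW.
  (* The threshold [ln 2 / 2] is used so that every prime, 2 included, lies strictly above it on the
     logarithmic scale. *)
  apply: signed_weight_prod_ge => //; first lra.
    apply/allP => p; rewrite mem_primes_upto => /andP[/prime_gt1 p1 _].
    apply: (@lt_le_trans _ _ 2); last by rewrite ler_nat.
    by rewrite -[ltRHS]lnK ?posrE // ltr_expR; lra.
  by apply: sign_nprod_le => //; apply: supp.
apply: le_trans (ler_sum_seq _ _ _ _ (fun x xN _ => ptw x xN)).
rewrite big_const_seq iter_addr_0 count_predT -[leRHS]mulr_natr /Bs.
set a := alpha `^ _; set n := (size _)%:R.
have -> : a * expR (- T) * n * ln N `^ e = a * n * (expR (- T) * ln N `^ e) by ring.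
rewrite ler_piMr ?mulr_ge0 ?powR_ge0 //.
rewrite powR_lnE // -expRD -[leRHS]expR0 ler_expR addrC subr_le0.
apply: le_trans (ler_norm _) _; rewrite normrM /T ler_wpM2l //.
have h1 : ln (ln 2) <= ln (ln N) by rewrite ler_ln ?posrE.
have h2 : ln (ln N) <= ln l0 by rewrite ler_ln ?posrE // ?ltW //; lra.
rewrite ler_norml; have := ler_norm (- ln (ln 2) : R); rewrite normrN.
have := ler_norm (ln l0); have := normr_ge0 (ln l0); have := normr_ge0 (ln (ln 2) : R).
by move=> *; apply/andP; split; lra.
Qed.
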